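(* Let $N=1$, $\alpha\in(0,1)$, $s\in(0,1)$ with $2s>1$, and $p\in[1,\infty]$. Let $u_0\in L^1(\mathbb{R})$ be non-negative and non-trivial, let $M=\int_{\mathbb{R}}u_0$, and let $u$ be the mild solution, with initial datum $u_0$, of $\partial_t^\alpha u+(-\Delta)^s u=0$ in $\mathbb{R}\times(0,\infty)$. Let $F$ be the profile of the fundamental solution of the equation, and let $B_r=\{x\in\mathbb{R}:|x|<r\}$. Then: (a) For any $\mu>0$, $$\big\|t^{\frac{\alpha}{2s}}u(\cdot,t)-MF(0)\big\|_{L^p(B_\mu)}\to0\quad\text{as }t\to\infty.$$ (b) For any $g:(0,\infty)\to(0,\infty)$ such that $g(t)\to\infty$ and $g(t)=o(t^{\frac{\alpha}{2s}})$ as $t\to\infty$, $$(g(t))^{-\frac1p}\big\|t^{\frac{\alpha}{2s}}u(\cdot,t)-MF(0)\big\|_{L^p(B_{g(t)})}\to0\quad\text{as }t\to\infty$$ (with $1/p=0$ if $p=\infty$).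
   Context: Here $\partial_t^\alpha$ is the Caputo derivative, $\partial_t^\alpha u(x,t)=\frac{1}{\Gamma(1-\alpha)}\,\partial_t\int_0^t\frac{u(x,\tau)-u(x,0)}{(t-\tau)^\alpha}\,d\tau$, and $(-\Delta)^s$ is the fractional Laplacian, with Fourier symbol $|k|^{2s}$. The fundamental solution $Z$ is the solution of the equation with a Dirac mass at the origin as initial datum; that is, for each $t>0$, $Z(\cdot,t)$ is the integrable function with $\int_{\mathbb{R}}e^{-ikx}Z(x,t)\,dx=E_\alpha(-|k|^{2s}t^\alpha)$, where $E_\alpha(z)=\sum_{j\ge0}\frac{z^j}{\Gamma(\alpha j+1)}$ is the Mittag-Leffler function. It has the self-similar form $Z(x,t)=t^{-\frac{\alpha}{2s}}F(xt^{-\frac{\alpha}{2s}})$, where the profile $F$ is positive, even, $C^\infty$ on $\mathbb{R}\setminus\{0\}$ and, since $2s>1$, continuous at the origin. The mild solution with initial datum $u_0$ is, by definition, $u(x,t)=\int_{\mathbb{R}}Z(x-y,t)u_0(y)\,dy$. *)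

(* Defs.v *)
From HB Require Import structures.
From mathcomp Require Import all_boot all_order all_algebra.
From mathcomp Require Import complex.
From mathcomp Require Import all_classical all_reals all_analysis.

Set Implicit Arguments.
Unset Strict Implicit.
Unset Printing Implicit Defensive.

Import Order.TTheory GRing.Theory Num.Theory.
Import numFieldNormedType.Exports.

Local Open Scope classical_set_scope.
Local Open Scope ring_scope.

(* The library has no filter_on instance for +oo; without it the littleo
   notation f =o_ +oo h does not elaborate. *)
Canonical pinfty_filter_on (R : realType) := FilterType (pinfty_nbhs R) _.

(* Euler's integral; only meaningful for 0 < a. *)
Definition Gamma {R : realType} (a : R) : R :=
  \int[lebesgue_measure]_(x in `]0, +oo[) (x `^ (a - 1) * expR (- x)).

Definition mittag_leffler {R : realType} (alpha z : R) : R :=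
  limn (series (fun j : nat => z ^+ j / Gamma (alpha * j%:R + 1))).

(* The integral of exp (- i k x) f x, split into real and imaginary parts since
   f is real-valued; a -i* b is the complex number a - i b. *)
Definition fourier {R : realType} (f : R -> R) (k : R) : R[i] :=
  ((\int[lebesgue_measure]_x (cos (k * x) * f x)) -i*
   (\int[lebesgue_measure]_x (sin (k * x) * f x)))%C.

(* The solution of the equation with a Dirac mass at the origin as initial
   datum, on the Fourier side. *)
Definition fundamental_solution {R : realType} (alpha s : R) (Z : R -> R -> R) :
    Prop :=
  forall t, 0 < t ->
    lebesgue_measure.-integrable setT (EFin \o (Z ^~ t)) /\
    forall k, fourier (Z ^~ t) k =
      (mittag_leffler alpha (- (`|k| `^ (2 * s) * t `^ alpha)))%:C%C.

(* Regularity selects the representative of the integrable function F, so that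
   F 0 makes sense. *)
Record profile {R : realType} (alpha s : R) (Z : R -> R -> R) (F : R -> R) :
    Prop := Profile {
  profile_self_similar : forall x t, 0 < t ->
    Z x t = t `^ (- (alpha / (2 * s))) * F (x * t `^ (- (alpha / (2 * s))));
  profile_gt0 : forall x, 0 < F x;
  profile_even : forall x, F (- x) = F x;
  profile_smooth : forall n x, x != 0 -> derivable (derive1n n F) x 1;
  profile_continuous0 : {for 0, continuous F} }.

Definition mild_solution {R : realType} (Z : R -> R -> R) (u0 : R -> R)
    (x t : R) : R :=
  \int[lebesgue_measure]_y (Z (x - y) t * u0 y).

(* The L^p(B) norm, computed on the line after extending f by 0 outside B; for
   p = +oo this is the essential supremum over B. *)
Definition Lnorm_on {R : realType} (p : \bar R) (B : set R) (f : R -> R) :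
    \bar R :=
  'N[lebesgue_measure]_p[EFin \o (f \_ B)].

(* Main.v *)
Require Import Defs.
From mathcomp Require Import all_boot all_order all_algebra.
From mathcomp Require Import all_classical all_reals all_analysis.
From mathcomp Require Import measurable_realfun ess_sup_inf.
From mathcomp Require Import ring lra.

Import Order.TTheory GRing.Theory Num.Theory.
Import numFieldNormedType.Exports.

Local Open Scope classical_set_scope.
Local Open Scope ring_scope.

(** Let [b = alpha / (2 s)]. By self-similarity, [t^b u(x, t) - M F(0)] is the
integral of [(F ((x - y) t^(-b)) - F 0) u0 y] over [y]. When [x] and [y] are
both small compared with [t^b], the factor in front of [u0 y] is small because
[F] is continuous at the origin; the mass that [u0] carries outside a large
interval is small, and it is multiplied by a bounded factor as soon as [F] is
bounded. So the deviation is uniformly small on [|x| <= d t^b]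
([deviation_uniform_small]). Passing to the L^p norm over a ball of radius [r]
costs the factor [(2 r)^(1/p)] ([Lnorm_on_ball_le]), constant in the first
claim and compensated by [g(t)^(-1/p)] in the second.

The substance is the bound [F x <= F 0] ([profile_le_origin]). An integrable
continuous function whose Fourier transform is real and non-negative is largest
at the origin ([le_at_origin_of_fourier_ge0]): smoothing it by a Cauchy kernel,
which is itself a superposition of cosines with positive weights, gives a
function with that property, and the kernel can be concentrated. The Fourier
transform of [F] is [E_alpha(- |k|^(2 s))], so it remains to see that the
Mittag-Leffler function is non-negative on the negative half-line
([mittag_leffler_ge0]).

For that, Euler's limit formula for the Gamma function
([Gamma_shift_cvg]) exhibits [E_alpha(-y)] as the limit, as [n] grows, of
[sum_j (-q)^j C(alpha j + n, n)] with [q = y / (n + 1)^alpha]. Such a sum is the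
coefficient of [z^n] in [sum_j (-q)^j (1 - z)^(- alpha j - 1)], that is, in
[1 / ((1 - z) + q (1 - z)^(1 - alpha))]. As [0 < alpha < 1], all coefficients of
the denominator but the constant one are non-positive, so its inverse has
non-negative coefficients ([multichoose_series_ge0]). *)

(** * The Gamma integral *)

(** The tangent-line bound on [ln] at the maximum of [x^c exp (-x / 2)], which is
    reached at [2 c]. *)
Lemma powR_le_expR {R : realType} (c : R) : 0 <= c ->
  exists2 C, 0 <= C & forall x, 0 < x -> x `^ c <= C * expR (x / 2).
Proof.
rewrite le_eqVlt => /predU1P[<-|c0].
  exists 1 => // x x0; rewrite powRr0 mul1r.
  by have := expR_ge1Dx (x / 2); lra.
exists (expR (c * (ln (2 * c) - 1))); first exact: expR_ge0.
move=> x x0; rewrite /powR gt_eqF// -expRD ler_expR.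
have y0 : 0 < x / (2 * c) by rewrite divr_gt0// mulr_gt0.
have h : ln (x / (2 * c)) <= x / (2 * c) - 1.
  by have := @le_ln1Dx R (x / (2 * c) - 1); rewrite (addrC 1) subrK; apply; lra.
rewrite lnM ?posrE ?invr_gt0 ?mulr_gt0// lnV ?posrE ?mulr_gt0// in h.
have -> : x / 2 = c * (x / (2 * c)) by field; rewrite gt_eqF.
rewrite -mulrDr ler_wpM2l ?(ltW c0)//; lra.
Qed.

Lemma measurable_powR_expRN {R : realType} (c : R) (D : set R) :
  measurable_fun D (fun x : R => x `^ c * expR (- x)).
Proof.
apply: (measurable_funS measurableT) => //.
apply: measurable_funM; first exact: measurable_powR.
by apply: measurableT_comp => //; exact: measurable_oppr.
Qed.

Lemma integrable_powR_expRN {R : realType} (c : R) : 0 <= c ->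
  lebesgue_measure.-integrable `]0, +oo[
    (EFin \o (fun x : R => x `^ c * expR (- x))).
Proof.
move=> c0; have [C C0 hC] := powR_le_expR c c0.
pose g (x : R) : \bar R := ((2 * C)%:E * (exponential_pdf (2^-1 : R) x)%:E)%E.
refine (@le_integrable _ _ R lebesgue_measure _ _ _ g _ _ _) => //.
- by apply/measurable_EFinP; exact: measurable_powR_expRN.
- move=> x /=; rewrite in_itv/= andbT => x0.
  rewrite lee_fin !ger0_norm ?mulr_ge0 ?powR_ge0 ?expR_ge0 ?exponential_pdf_ge0//.
  rewrite exponential_pdfE ?(ltW x0)//.
  rewrite (_ : 2 * C * (2^-1 * _) = C * expR (- 2^-1 * x)); last by field.
  rewrite (_ : - 2^-1 * x = x / 2 + - x); last by lra.
  by rewrite expRD mulrA ler_wpM2r ?expR_ge0// hC.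
- apply: integrableZl => //; apply: integrableS (integrable_exponential_pdf _) => //.
Qed.

Lemma Gamma_integral {R : realType} (a : R) : 1 <= a ->
  (Gamma a)%:E =
  (\int[lebesgue_measure]_(x in `]0%R, +oo[) (x `^ (a - 1) * expR (- x))%:E)%E.
Proof.
move=> a1; rewrite /Gamma /Rintegral fineK//.
apply: integrable_fin_num => //; apply: integrable_powR_expRN; lra.
Qed.

Lemma powR_cvg0r {R : realType} (c : R) : 0 <= c ->
  x `^ c @[x --> (0 : R)^'+] --> (0 : R) `^ c.
Proof.
rewrite le_eqVlt => /predU1P[<-|c0].
  by rewrite powRr0; under eq_fun do rewrite powRr0; exact: cvg_cst.
by rewrite powR0 ?gt_eqF//; exact: powR_cvg0.
Qed.

Lemma is_derive_powR {R : realType} (a x : R) : 0 < x ->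
  is_derive x (1 : R) (fun y : R => y `^ a) (a * x `^ (a - 1)).
Proof.
move=> x0; have xin : x \in `]0, +oo[ by rewrite in_itv/= x0.
apply: DeriveDef; first exact: derivable_powR.
by rewrite -derive1E powR_derive1.
Qed.

Lemma continuous_powR {R : realType} (a x : R) : 0 < x ->
  {for x, continuous (fun y : R => y `^ a)}.
Proof.
move=> x0; apply/differentiable_continuous/derivable1_diffP.
by have [] := is_derive_powR a x x0.
Qed.

Lemma powR_expRN_cvgy {R : realType} (a : R) : 0 <= a ->
  x `^ a * expR (- x) @[x --> +oo] --> (0 : R).
Proof.
move=> a0; have [C C0 hC] := powR_le_expR a a0.
apply: (@squeeze_cvgr _ _ _ _ (cst 0) (fun x => C * expR (- (x / 2)))).
- near=> x.
  have x0 : 0 < x by near: x; exact: nbhs_pinfty_gt.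
  rewrite mulr_ge0 ?powR_ge0 ?expR_ge0//=.
  rewrite (_ : - (x / 2) = x / 2 + - x); last by lra.
  by rewrite expRD mulrA ler_wpM2r ?expR_ge0// hC.
- exact: cvg_cst.
- rewrite -(mulr0 C); apply: cvgMr.
  apply: (@cvg_comp _ _ _ (fun x => x / 2) (fun x => expR (- x))
    _ (pinfty_nbhs R)); last exact: cvgr_expR.
  exact: gt0_cvgMly.
Unshelve. all: by end_near. Qed.

(** The primitive [x^a exp (-x)] of [a x^(a - 1) exp (-x) - x^a exp (-x)] vanishes
    at both ends of the half-line. Its derivative changes sign only at [a], so the
    half-line is cut there and each piece is integrated with a constant sign. *)
Lemma GammaS {R : realType} (a : R) : 1 <= a -> Gamma (a + 1) = a * Gamma a.
Proof.
move=> a1; have a0 : 0 < a by lra.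
pose g x : R := x `^ a * expR (- x).
pose f x : R := x `^ (a - 1) * expR (- x) * (a - x).
have fE (x : R) : 0 <= x -> f x = a * (x `^ (a - 1) * expR (- x)) - g x.
  move=> x0; rewrite /f /g mulrBr mulrC; congr (_ - _).
  rewrite mulrAC; congr (_ * _); rewrite -[X in _ * X](powRr1 x0) -powRD ?subrK//.
  by rewrite gt_eqF.
have dg (x : R) : 0 < x -> is_derive x (1 : R) g (f x).
  move=> x0; rewrite fE ?ltW//.
  have := is_derive_powR a x x0; move=> dp.
  apply: is_derive_eq.
  rewrite /GRing.scale /= /g; ring.
have cg : g x @[x --> 0^'+] --> g 0.
  apply: cvgM; first by apply: powR_cvg0r; exact: ltW.
  apply/cvg_at_right_filter; apply: continuous_comp; first exact: opp_continuous.
  exact: continuous_expR.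
have g0 : g 0 = 0 by rewrite /g powR0 ?gt_eqF// mul0r.
have cf0 : f x @[x --> 0^'+] --> f 0.
  apply: cvgM; first apply: cvgM.
  - by apply: powR_cvg0r; lra.
  - apply/cvg_at_right_filter; apply: continuous_comp; first exact: opp_continuous.
    exact: continuous_expR.
  - by apply/cvg_at_right_filter; apply: cvgB; [exact: cvg_cst|exact: cvg_id].
have cfx (x : R) : 0 < x -> {for x, continuous f}.
  move=> x0; apply: cvgM; first apply: cvgM.
  - exact: continuous_powR.
  - by apply: continuous_comp; [exact: opp_continuous|exact: continuous_expR].
  - by apply: cvgB; [exact: cvg_cst|exact: cvg_id].
have cf : {within `[0, +oo[, continuous f}.
  apply/continuous_within_itvcyP; split => // x.
  by rewrite in_itv/= andbT => /cfx.
have cga : {for a, continuous g}.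
  apply/differentiable_continuous/derivable1_diffP.
  by have [] := dg a a0.
(* On each side of [a] the function [f] has constant sign. *)
have I1 : (\int[lebesgue_measure]_(x in `[0%R, a]) (f x)%:E = (g a)%:E - (g 0)%:E)%E.
  apply: continuous_FTC2 => //.
  - by apply: continuous_subspaceW cf; exact: subset_itvl.
  - split => //.
    + by move=> x; rewrite in_itv/= => /andP[x0 _]; have [] := dg x x0.
    + exact: cvg_at_left_filter.
  - move=> x; rewrite in_itv/= => /andP[x0 _].
    by rewrite derive1E; have [_ ->] := dg x x0.
have I2 : (\int[lebesgue_measure]_(x in `[a, +oo[) (f x)%:E = 0%:E - (g a)%:E)%E.
  apply: le0_continuous_FTC2y.
  - move=> x ax; rewrite /f mulr_ge0_le0 ?mulr_ge0 ?powR_ge0 ?expR_ge0//; lra.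
  - by apply: continuous_subspaceW cf; apply: subset_itvr; rewrite bnd_simp ltW.
  - by apply: powR_expRN_cvgy; exact: ltW.
  - exact: cvg_at_right_filter.
  - by move=> x ax; have [] := dg x (lt_trans a0 ax).
  - move=> x; rewrite in_itv/= andbT => ax.
    by rewrite derive1E; have [_ ->] := dg x (lt_trans a0 ax).
have mf D : measurable_fun D (EFin \o f).
  apply/measurable_EFinP; apply: measurable_funM; first exact: measurable_powR_expRN.
  by apply: measurable_funB; [exact: measurable_cst|exact: measurable_id].
have i1 : lebesgue_measure.-integrable `]0, +oo[ (EFin \o (fun x : R => x `^ (a - 1) * expR (- x))).
  by apply: integrable_powR_expRN; lra.
have i2 : lebesgue_measure.-integrable `]0, +oo[ (EFin \o g).
  by apply: integrable_powR_expRN; lra.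
have if_ : lebesgue_measure.-integrable `]0, +oo[ (EFin \o f).
  have i3 := @integrableZl _ _ R lebesgue_measure `]0, +oo[%classic (measurable_itv _) a _ i1.
  have i4 := @integrableB _ _ R lebesgue_measure `]0, +oo[%classic (measurable_itv _) _ _ i3 i2.
  refine (@eq_integrable _ _ R lebesgue_measure `]0, +oo[%classic (measurable_itv _) _ _ _ i4).
  move=> x; rewrite inE/= in_itv/= andbT => x0.
  by rewrite fE ?ltW.
have : \int[lebesgue_measure]_(x in `]0, +oo[) f x = 0.
  rewrite /Rintegral (integral_itv_obnd_cbnd (mf _)).
  have -> : `[0, +oo[%classic = `[0, a]%classic `|` `]a, +oo[%classic.
    by rewrite -itv_bndbnd_setU// bnd_simp ltW.
  have dj : [disjoint `[0, a]%classic & `]a, +oo[%classic].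
    apply/disj_set2P; rewrite -subset0 => x [/=].
    rewrite !in_itv/= andbT => /andP[_ h1] h2.
    by move: (lt_le_trans h2 h1); rewrite ltxx.
  rewrite (@integral_setU _ _ R lebesgue_measure _ _ _
    (measurable_itv _) (measurable_itv _) (mf _) dj).
  by rewrite I1 (integral_itv_obnd_cbnd (mf _)) I2 g0 /= subr0 sub0r subrr.
rewrite (_ : \int[lebesgue_measure]_(x in `]0, +oo[) f x = a * Gamma a - Gamma (a + 1)).
  by move=> /eqP; rewrite subr_eq0 => /eqP.
rewrite /Gamma addrK -RintegralZl// -RintegralB//; last exact: (integrableZl _ a i1).
apply: eq_Rintegral => x; rewrite inE/= in_itv/= andbT => x0.
by rewrite fE ?ltW.
Qed.

Lemma Gamma1 {R : realType} : Gamma (1 : R) = 1.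
Proof.
have := @integral_exponential_pdf R 1 ltr01.
rewrite -(setUv `[0%R, +oo[%classic) => h.
apply: EFin_inj; rewrite Gamma_integral// -h.
have mE D : measurable_fun D (EFin \o (exponential_pdf (1:R))).
  by apply/measurable_EFinP; apply: measurable_funTS; exact: measurable_exponential_pdf.
rewrite subrr integral_itv_obnd_cbnd; last first.
  by apply/measurable_EFinP; exact: measurable_powR_expRN.
have mC : measurable (~` (`[0%R, +oo[%classic : set R)) by exact: measurableC.
rewrite (@ge0_integral_setU _ _ R lebesgue_measure _ _
  (measurable_itv _) mC _ (mE _)); last 2 first.
- by move=> x _; rewrite lee_fin exponential_pdf_ge0.
- exact/disj_setPCl.
rewrite [X in (_ + X)%E]integral0_eq ?adde0; last first.
  move=> x /=; rewrite in_itv/= andbT => /negP; rewrite -ltNge => x0.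
  by rewrite lt0_exponential_pdf.
apply: eq_integral => x; rewrite inE/= in_itv/= andbT => x0.
by rewrite /= exponential_pdfE// powRr0 !mul1r mulN1r.
Qed.

(** A crude form of the lower Stirling bound: keep only the interval [(x, x + 1)]
    of the integral. *)
Lemma Gamma_ge {R : realType} (x : R) : 0 <= x ->
  x `^ x * expR (- (x + 1)) <= Gamma (x + 1).
Proof.
move=> x0; rewrite -lee_fin Gamma_integral; last by lra.
rewrite addrK.
apply: (@le_trans _ _ (\int[lebesgue_measure]_(y in `]x, (x + 1)%R[)
  (y `^ x * expR (- y))%:E)%E); last first.
  apply: ge0_subset_integral => //.
  - by apply/measurable_EFinP; exact: measurable_powR_expRN.
  - by move=> y _; rewrite lee_fin mulr_ge0 ?powR_ge0 ?expR_ge0.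
  - by apply: subset_itv; rewrite bnd_simp.
rewrite (_ : (x `^ x * expR (- (x + 1)))%:E =
  (\int[lebesgue_measure]_(y in `]x, (x + 1)%R[) (x `^ x * expR (- (x + 1)))%:E)%E); last first.
  rewrite integral_cst//= lebesgue_measure_itv/= lte_fin ltrDl ltr01 -EFinB.
  by rewrite (addrC x) addrK mule1.
apply: ge0_le_integral => //.
- by move=> y _; rewrite lee_fin mulr_ge0 ?powR_ge0 ?expR_ge0.
- by apply/measurable_EFinP; exact: measurable_powR_expRN.
- move=> y; rewrite /= in_itv/= => /andP[xy yx].
  rewrite lee_fin ler_pM ?powR_ge0 ?expR_ge0 ?ler_expR ?lerN2 ?(ltW yx)//.
  by rewrite ge0_ler_powR ?nnegrE// ?(ltW xy)//; lra.
Qed.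

Lemma Gamma_gt0 {R : realType} (a : R) : 1 <= a -> 0 < Gamma a.
Proof.
move=> a1; rewrite -(subrK 1 a).
have [->|n1] := eqVneq a 1; first by rewrite subrr add0r Gamma1.
have a1' : 0 <= a - 1 by lra.
apply: (lt_le_trans _ (Gamma_ge _ a1')).
rewrite mulr_gt0 ?expR_gt0 ?powR_gt0//.
by rewrite subr_gt0 lt_neqAle eq_sym n1.
Qed.

(** Young's inequality for [r^x] and 1 with exponents [1 / x] and [1 / (1 - x)]. *)
Lemma powR_bernoulli {R : realType} (r x : R) : 0 < r -> 0 <= x <= 1 ->
  r `^ x <= 1 + x * (r - 1).
Proof.
move=> r0 /andP[x0 x1].
have [->|xn0] := eqVneq x 0; first by rewrite powRr0 mul0r addr0.
have x0' : 0 < x by rewrite lt_neqAle eq_sym xn0.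
have [->|xn1] := eqVneq x 1; first by rewrite powRr1 ?(ltW r0)// mul1r addrC subrK.
have x1' : x < 1 by rewrite lt_neqAle xn1.
have := @conjugate_powR R (r `^ x) 1 x^-1 (1 - x)^-1 (powR_ge0 _ _) ler01.
rewrite !invr_gt0 subr_gt0 !invrK mulr1 powR1 -powRrM mulfV// powRr1 ?(ltW r0)//.
move=> /(_ x0' x1'); rewrite addrCA subrr addr0 => /(_ erefl).
by move=> h; apply: (le_trans h); lra.
Qed.

(** One half of log-convexity: apply [powR_bernoulli] to [t / a] under the integral
    sign. The bound has the mean [a] of the Gamma density as its tangency point, so
    the linear terms cancel by [GammaS]. *)
Lemma GammaD_le {R : realType} (a x : R) : 1 <= a -> 0 <= x <= 1 ->
  Gamma (a + x) <= a `^ x * Gamma a.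
Proof.
move=> a1 x01; have a0 : 0 < a by lra.
have -> : a `^ x * Gamma a =
    a `^ x * (1 - x) * Gamma a + a `^ x * x / a * Gamma (a + 1).
  by rewrite GammaS//; field; rewrite gt_eqF.
have i1 := @integrable_powR_expRN R (a - 1) ltac:(lra).
have i2 := @integrable_powR_expRN R (a + 1 - 1) ltac:(lra).
have i3 := @integrable_powR_expRN R (a + x - 1) ltac:(lra).
rewrite /Gamma -!RintegralZl// -RintegralD//; last 2 first.
- exact: (@integrableZl _ _ R lebesgue_measure _ (measurable_itv _) _ _ i1).
- exact: (@integrableZl _ _ R lebesgue_measure _ (measurable_itv _) _ _ i2).
apply: le_Rintegral => //.
  have j1 := @integrableZl _ _ R lebesgue_measure _ (measurable_itv _) (a `^ x * (1 - x)) _ i1.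
  have j2 := @integrableZl _ _ R lebesgue_measure _ (measurable_itv _) (a `^ x * x / a) _ i2.
  exact: (@integrableD _ _ R lebesgue_measure _ (measurable_itv _) _ _ j1 j2).
move=> t; rewrite /= in_itv/= andbT => t0.
rewrite !mulrA -mulrDl ler_wpM2r ?expR_ge0//.
have := powR_bernoulli (t / a) x (divr_gt0 t0 a0) x01.
move=> h.
have -> : t `^ (a + x - 1) = t `^ (a - 1) * (a `^ x * (t / a) `^ x).
  rewrite -powRM ?divr_ge0 ?ltW// (mulrC a) divfK ?gt_eqF// -powRD ?(gt_eqF t0) ?implybT//.
  by congr powR; lra.
have -> : t `^ (a + 1 - 1) = t `^ (a - 1) * t.
  by rewrite -{3}(powRr1 (ltW t0)) -powRD ?(gt_eqF t0) ?implybT//; congr powR; lra.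
apply: (@le_trans _ _ (t `^ (a - 1) * (a `^ x * (1 + x * (t / a - 1))))).
  by rewrite !ler_wpM2l ?powR_ge0.
rewrite le_eqVlt; apply/orP; left; apply/eqP; field; by rewrite gt_eqF.
Qed.

(** A bound for arbitrary shifts, needed uniformly in [x] to dominate the series
    below; unit steps come from [GammaS], the fractional remainder from [GammaD_le]. *)
Lemma GammaD_le_powR {R : realType} (a x : R) : 1 <= a -> 0 <= x ->
  Gamma (a + x) <= (a + x) `^ x * Gamma a.
Proof.
move=> a1 x0.
have [n] : exists n : nat, x <= n%:R.
  exists (Num.truncn x).+1; exact/ltW/truncnS_gt.
elim: n x x0 => [|n IH] x x0 xn.
  have -> : x = 0 by apply/eqP; rewrite eq_le x0 andbT.
  by rewrite powRr0 addr0 mul1r.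
have [x1|x1] := leP x 1.
  apply: (le_trans (GammaD_le _ _ a1 _)); first by rewrite x0.
  rewrite ler_wpM2r ?(ltW (Gamma_gt0 _ _))// ge0_ler_powR ?nnegrE//; lra.
rewrite -[X in Gamma (a + X)](subrK 1) addrA GammaS; last by lra.
have h : Gamma (a + (x - 1)) <= (a + (x - 1)) `^ (x - 1) * Gamma a.
  by apply: IH; [lra|move: xn; rewrite -natr1; lra].
apply: (@le_trans _ _ ((a + x) * ((a + x) `^ (x - 1) * Gamma a))).
  apply: ler_pM => //; [lra|by apply/ltW/Gamma_gt0; lra|lra|].
  apply: (le_trans h); rewrite ler_wpM2r ?(ltW (Gamma_gt0 _ _))//.
  by rewrite ge0_ler_powR ?nnegrE//; lra.
by rewrite mulrA mulr_powRB1//; lra.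
Qed.

(** * Coefficients of powers of 1 - z *)

(** The coefficient of [z^n] in the binomial series of [(1 - z)^(-x)]; for a natural
    number [x] it counts multisets of size [n] over [x] elements. *)
Definition multichoose {R : realType} (x : R) (n : nat) : R :=
  (\prod_(i < n) (x + i%:R)) / n`!%:R.

Lemma multichoose0 {R : realType} (x : R) : multichoose x 0 = 1.
Proof. by rewrite /multichoose big_ord0 fact0 divr1. Qed.

Lemma multichooseS {R : realType} (x : R) n :
  n.+1%:R * multichoose x n.+1 = (x + n%:R) * multichoose x n.
Proof.
rewrite /multichoose big_ord_recr factS natrM /=; field.
by rewrite pnatr_eq0 -lt0n fact_gt0 /= addrC natr1 pnatr_eq0.
Qed.

Lemma multichoose_ge0 {R : realType} (x : R) n : 0 <= x -> 0 <= multichoose x n.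
Proof.
by move=> x0; rewrite divr_ge0//; apply: prodr_ge0 => i _; rewrite addr_ge0.
Qed.

Lemma multichooseS_le0 {R : realType} (x : R) n : -1 <= x <= 0 ->
  multichoose x n.+1 <= 0.
Proof.
move=> /andP[x1 x0]; rewrite /multichoose big_ord_recl addr0.
rewrite mulr_le0_ge0 ?invr_ge0// mulr_le0_ge0//.
by apply: prodr_ge0 => i _; rewrite lift0 -natr1; have := ler0n R i; lra.
Qed.

(** Vandermonde's identity, i.e. [(1 - z)^(-x) (1 - z)^(-y) = (1 - z)^(-(x + y))].
    Multiplying the convolution by [n + 1 = k + (n + 1 - k)] lets [multichooseS] act
    on either factor. *)
Lemma multichooseD {R : realType} (x y : R) n :
  \sum_(k < n.+1) multichoose x k * multichoose y (n - k) = multichoose (x + y) n.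
Proof.
elim: n => [|n IH]; first by rewrite big_ord1 !multichoose0 mulr1.
apply: (@mulfI _ n.+1%:R); first by rewrite pnatr_eq0.
rewrite multichooseS -IH !mulr_sumr.
have -> : \sum_(i < n.+2) n.+1%:R * (multichoose x i * multichoose y (n.+1 - i)) =
  \sum_(i < n.+2) (i%:R * multichoose x i) * multichoose y (n.+1 - i) +
  \sum_(i < n.+2) multichoose x i * ((n.+1 - i)%:R * multichoose y (n.+1 - i)).
  rewrite -big_split; apply: eq_bigr => i _ /=.
  by rewrite natrB ?(leq_ord i)//; ring.
rewrite big_ord_recl mul0r mul0r add0r.
rewrite [X in _ + X]big_ord_recr /= subnn mul0r mulr0 addr0 -big_split /=.
apply: eq_bigr => i _; rewrite /bump add1n multichooseS subSS.
have le_in : (i <= n)%N by rewrite -ltnS.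
rewrite (subSn le_in) multichooseS natrB//; ring.
Qed.

(** The constant [e] is free, so growth in [x] is slower than any given exponential;
    this comes from [u^n / n! <= exp u] at [u = e (x + n)]. *)
Lemma multichoose_le {R : realType} (e x : R) n : 0 < e -> 0 <= x ->
  multichoose x n <= e^-1 ^+ n * expR (e * (x + n%:R)).
Proof.
move=> e0 x0; have xn : 0 <= e * (x + n%:R) by rewrite mulr_ge0 ?addr_ge0// ltW.
apply: (@le_trans _ _ ((x + n%:R) ^+ n / n`!%:R)).
  rewrite ler_wpM2r ?invr_ge0//.
  rewrite -[X in _ <= _ ^+ X]card_ord -prodr_const; apply: ler_prod => i _.
  by rewrite addr_ge0//= lerD2l ler_nat ltnW.
have h : (e * (x + n%:R)) ^+ n / n`!%:R <= expR (e * (x + n%:R)).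
  case: n xn => [|n] xn.
    by rewrite expr0 fact0 divr1; have := expR_ge1Dx (e * (x + 0%:R)); lra.
  by have := expR_ge1Dxn n xn; lra.
rewrite mulrC ler_pdivrMl ?ltr0n ?fact_gt0//.
have -> : (x + n%:R) ^+ n = e^-1 ^+ n * (e * (x + n%:R)) ^+ n.
  by rewrite -exprMn mulrA mulVf ?gt_eqF// mul1r.
rewrite mulrCA ler_wpM2l ?exprn_ge0 ?invr_ge0 ?(ltW e0)//.
by rewrite -ler_pdivrMl ?ltr0n ?fact_gt0// mulrC.
Qed.

(** With [e = - ln q / (2 alpha)] in [multichoose_le], the product is bounded by a
    multiple of [sqrt q ^ J]. *)
Lemma cvg_expr_multichoose {R : realType} (alpha q : R) n :
  0 < alpha -> 0 < q < 1 ->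
  (- q) ^+ J * multichoose (alpha * J%:R) n @[J --> \oo] --> (0 : R).
Proof.
move=> a0 /andP[q0 q1].
(* This rate makes [r = q * expR (e * alpha)] the square root of [q]. *)
pose e := - ln q / (2 * alpha).
have e0 : 0 < e by rewrite divr_gt0 ?mulr_gt0// oppr_gt0 ln_lt0// q0 q1.
pose C := e^-1 ^+ n * expR (e * n%:R).
pose r := q * expR (e * alpha).
have r1 : r < 1.
  rewrite /r -[X in X * _](lnK q0) -expRD -expR0 ltr_expR.
  rewrite (_ : e * alpha = - ln q / 2) ?/e; last by field; rewrite gt_eqF.
  by have := ln_lt0 (introT andP (conj q0 q1)); lra.
have r0 : 0 <= r by rewrite mulr_ge0 ?expR_ge0 ?ltW.
apply: norm_cvg0.
apply: (@squeeze_cvgr _ _ _ _ (cst 0) (fun J => C * r ^+ J)).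
- apply: nearW => J; rewrite normr_ge0/= normrM normrX normrN.
  rewrite (ger0_norm (ltW q0)) (ger0_norm (multichoose_ge0 _ _ _)) ?mulr_ge0 ?(ltW a0)//.
  have aJ : 0 <= alpha * J%:R by rewrite mulr_ge0// ltW.
  have -> : C * r ^+ J = q ^+ J * (e^-1 ^+ n * expR (e * (alpha * J%:R + n%:R))).
    by rewrite /C /r exprMn -expRM_natr mulrDr expRD (mulrA e); ring.
  by rewrite ler_wpM2l ?exprn_ge0 ?(ltW q0)//; exact: multichoose_le.
- exact: cvg_cst.
- rewrite -(mulr0 C); apply: cvgMr; apply: cvg_expr; by rewrite ger0_norm.
Qed.

(** The limits are the coefficients of [1 / phi], where
    [phi = (1 - z) + q (1 - z)^(1 - alpha)]. Truncating the geometric series that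
    expands [1 / phi] and multiplying back by [phi] telescopes, so the truncated
    coefficients satisfy the recursion of [1 / phi] up to a vanishing error.
    Since [phi] has a positive constant coefficient and non-positive other ones, the
    recursion yields existence and sign of the limit by induction on [n]. *)
Lemma multichoose_series_ge0 {R : realType} (alpha q : R) n :
  0 < alpha < 1 -> 0 < q < 1 ->
  exists2 l : R, 0 <= l &
   (\sum_(j < J) (- q) ^+ j * multichoose (alpha * j%:R + 1) n) @[J --> \oo] --> l.
Proof.
move=> /andP[a0 a1] /andP[q0 q1].
pose A n J := \sum_(j < J) (- q) ^+ j * multichoose (alpha * j%:R + 1) n.
(* [phi k] is the coefficient of [z^k] in [(1 - z) + q (1 - z)^(1 - alpha)]. *)
pose phi k := multichoose (-1) k + q * multichoose (alpha - 1) k.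
have phi0 : phi 0 = 1 + q by rewrite /phi !multichoose0 mulr1.
have phiS k : phi k.+1 <= 0.
  have h1 : multichoose (-1 : R) k.+1 <= 0 by apply: multichooseS_le0; lra.
  have h2 : q * multichoose (alpha - 1) k.+1 <= 0.
    by rewrite mulr_ge0_le0 ?(ltW q0)//; apply: multichooseS_le0; lra.
  by rewrite /phi; lra.
have AE m J : \sum_(k < m.+1) phi k * A (m - k)%N J =
    multichoose 0 m - (- q) ^+ J * multichoose (alpha * J%:R) m.
  under eq_bigr do rewrite mulr_sumr.
  rewrite exchange_big /=.
  have -> : \sum_(j < J) \sum_(i < m.+1)
      phi i * ((- q) ^+ j * multichoose (alpha * j%:R + 1) (m - i)) =
    \sum_(j < J) ((- q) ^+ j * multichoose (alpha * j%:R) m -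
       (- q) ^+ j.+1 * multichoose (alpha * j.+1%:R) m).
    apply: eq_bigr => j _.
    have -> : multichoose (alpha * j%:R) m = \sum_(i < m.+1)
        multichoose (-1) i * multichoose (alpha * j%:R + 1) (m - i).
      by rewrite multichooseD; congr multichoose; ring.
    have -> : multichoose (alpha * j.+1%:R) m = \sum_(i < m.+1)
        multichoose (alpha - 1) i * multichoose (alpha * j%:R + 1) (m - i).
      by rewrite multichooseD -natr1; congr multichoose; ring.
    rewrite !mulr_sumr -sumrB; apply: eq_bigr => i _.
    by rewrite /phi exprS; ring.
  elim: J => [|J IH]; first by rewrite big_ord0 expr0 mul1r mulr0 subrr.
  by rewrite big_ord_recr IH /=; ring.
suff [l l0 hl] : exists2 l : R, 0 <= l & A n J @[J --> \oo] --> l by exists l.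
elim/ltn_ind: n => m IH.
have /choice[l hl] : forall k : nat, exists l : R, (k < m)%N ->
    0 <= l /\ A k J @[J --> \oo] --> l.
  move=> k; have [km|] := ltnP k m; last by exists 0.
  by have [l l0 h] := IH k km; exists l.
have q1' : 0 < 1 + q by lra.
exists ((multichoose 0 m - \sum_(k < m) phi k.+1 * l (m - k.+1)%N) / (1 + q)).
  rewrite divr_ge0 ?(ltW q1')// subr_ge0 (@le_trans _ _ 0) ?multichoose_ge0//.
  apply: sumr_le0 => i _; rewrite mulr_le0_ge0//.
  have /hl[]// : (m - i.+1 < m)%N by rewrite ltn_subrL (leq_trans _ (ltn_ord i)).
have -> : A m = fun J => (multichoose 0 m - (- q) ^+ J * multichoose (alpha * J%:R) m
   - \sum_(k < m) phi k.+1 * A (m - k.+1)%N J) / (1 + q).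
  apply/funext => J; have := AE m J; rewrite big_ord_recl subn0 phi0 => <-.
  rewrite (eq_bigr (fun k : 'I_m => phi k.+1 * A (m - k.+1)%N J)) ?addrK.
    by rewrite mulrC mulKf ?gt_eqF.
  by move=> i _; rewrite lift0.
apply: cvgMl; apply: cvgB.
  rewrite -[X in _ --> X]subr0; apply: cvgB; first exact: cvg_cst.
  by apply: cvg_expr_multichoose; rewrite ?q0.
apply: cvg_big => [|i _]; first exact: add_continuous.
apply: cvgMr.
have /hl[]// : (m - i.+1 < m)%N by rewrite ltn_subrL (leq_trans _ (ltn_ord i)).
Qed.

(** * Euler's limit formula *)

Lemma Gamma_multichoose {R : realType} (a : R) n : 1 <= a ->
  Gamma (a + n%:R) = Gamma a * multichoose a n * n`!%:R.
Proof.
move=> a1; elim: n => [|n IH]; first by rewrite addr0 multichoose0 !mulr1.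
rewrite -natr1 addrA GammaS; last by have := ler0n R n; lra.
by rewrite IH factS natrM (mulrA _ n.+1%:R) -(mulrA _ _ n.+1%:R) (mulrC _ n.+1%:R)
  multichooseS; ring.
Qed.

Lemma Gamma_nat {R : realType} n : Gamma (n.+1%:R : R) = n`!%:R.
Proof.
elim: n => [|n IH]; first exact: Gamma1.
by rewrite -natr1 GammaS ?IH ?ler1n// factS natrM.
Qed.

(** For [x <= 1] the ratio lies between [1 - x / (n + 1)] and 1, by [GammaD_le] at
    [n + 1] with shift [x] and at [n + 1 + x] with shift [1 - x]. Larger [x] are
    reached by unit steps, each multiplying the ratio by a factor tending to 1. *)
Lemma Gamma_shift_cvg {R : realType} (x : R) : 0 <= x ->
  Gamma (n.+1%:R + x) / (Gamma n.+1%:R * n.+1%:R `^ x) @[n --> \oo] --> (1 : R).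
Proof.
have [N] : exists N : nat, x <= N%:R.
  exists (Num.truncn x).+1; exact/ltW/truncnS_gt.
elim: N x => [|N IH] x xN x0.
  have -> : x = 0 by apply/eqP; rewrite eq_le x0 andbT.
  apply: cvg_near_cst; apply: nearW => n.
  by rewrite powRr0 addr0 mulr1 divff// gt_eqF// Gamma_gt0// ler1n.
have [x1|x1] := leP x 1.
  apply: (@squeeze_cvgr _ _ _ _ (fun n => 1 - x * harmonic n) (cst 1)).
  - apply: nearW => n /=; set a := n.+1%:R.
    have a1 : 1 <= a :> R by rewrite ler1n.
    have a0 : 0 < a by lra.
    have G0 := Gamma_gt0 a a1.
    have D0 : 0 < Gamma a * a `^ x by rewrite mulr_gt0// powR_gt0.
    apply/andP; split; last first.
      by rewrite ler_pdivrMr// mul1r mulrC GammaD_le ?x0.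
    rewrite ler_pdivlMr//.
    have x1' : 0 <= 1 - x <= 1 by apply/andP; split; lra.
    have := GammaD_le (a + x) (1 - x) ltac:(lra) x1'.
    rewrite (_ : a + x + (1 - x) = a + 1) ?GammaS//; last by ring.
    move=> h.
    have ax0 : 0 < a + x by lra.
    have p0 : 0 < (a + x) `^ (1 - x) by rewrite powR_gt0.
    have h1 : a `^ x * a `^ (1 - x) = a.
      by rewrite -powRD ?(gt_eqF a0) ?implybT// addrC subrK powRr1 ?ltW.
    have an0 : a != 0 by rewrite gt_eqF.
    have h2 : (1 - x / a) * (a + x) `^ (1 - x) <= a `^ (1 - x).
      rewrite -(divfK an0 (a + x)) (_ : (a + x) / a = 1 + x / a); last first.
        by field.
      have u0 : 0 <= x / a by rewrite divr_ge0// ltW.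
      have u1 : 0 <= 1 + x / a by rewrite addr_ge0.
      rewrite (powRM _ u1 (ltW a0)).
      rewrite mulrA ler_piMl ?powR_ge0//.
      have [v0|v0] := leP (1 - x / a) 0.
        by apply: (@le_trans _ _ 0) => //; rewrite mulr_le0_ge0 ?powR_ge0.
      apply: (@le_trans _ _ ((1 - x / a) * (1 + x / a))).
        by rewrite ler_wpM2l ?(ltW v0)// ler1_powR ?lerDl// gerBl.
      by rewrite -subr_sqr expr1n gerBl sqr_ge0.
    rewrite -(ler_pM2l p0); apply: le_trans h.
    have -> : a * Gamma a = Gamma a * a `^ x * a `^ (1 - x).
      by rewrite -mulrA h1 mulrC.
    rewrite (mulrC ((a + x) `^ _)) mulrAC mulrC ler_wpM2l ?(ltW D0)//.
  - rewrite -[X in _ --> X]subr0 -(mulr0 x); apply: cvgB; first exact: cvg_cst.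
    by apply: cvgMr; exact: cvg_harmonic.
  - exact: cvg_cst.
have -> : (fun n => Gamma (n.+1%:R + x) / (Gamma n.+1%:R * n.+1%:R `^ x)) =
  fun n => Gamma (n.+1%:R + (x - 1)) / (Gamma n.+1%:R * n.+1%:R `^ (x - 1)) *
     (1 + (x - 1) * harmonic n).
  apply/funext => n /=; set a := n.+1%:R.
  have a1 : 1 <= a :> R by rewrite ler1n.
  have a0 : 0 < a by lra.
  rewrite -[X in a + X](subrK 1 x) addrA GammaS; last by lra.
  rewrite -(mulr_powRB1 (ltW a0)); last by lra.
  field; rewrite !gt_eqF ?powR_gt0 ?Gamma_gt0//.
rewrite -[X in _ --> X]mulr1; apply: cvgM.
  by apply: IH; [move: xN; rewrite -natr1; lra|lra].
rewrite -[X in _ --> X]addr0 -(mulr0 (x - 1)); apply: cvgD; first exact: cvg_cst.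
by apply: cvgMr; exact: cvg_harmonic.
Qed.

(** * Non-negativity of the Mittag-Leffler function *)

(** Up to the ratio of Euler's limit formula, the terms of the series of
    [multichoose_series_ge0] at [q = y / (n + 1)^alpha] are those of the
    Mittag-Leffler series at [-y]. *)
Lemma multichoose_shift {R : realType} (alpha y : R) n j : 0 < alpha -> 0 <= y ->
  (- (y / n.+1%:R `^ alpha)) ^+ j * multichoose (alpha * j%:R + 1) n =
  (- y) ^+ j * (Gamma (n.+1%:R + alpha * j%:R) /
     (Gamma n.+1%:R * n.+1%:R `^ (alpha * j%:R))) / Gamma (alpha * j%:R + 1).
Proof.
move=> a0 y0; set x := alpha * j%:R.
have x0 : 0 <= x by rewrite mulr_ge0 ?(ltW a0).
have -> : n.+1%:R + x = (x + 1) + n%:R by rewrite -natr1; ring.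
rewrite Gamma_multichoose ?lerDr// Gamma_nat -mulNr exprMn exprVn.
rewrite powRrM powR_mulrn ?powR_ge0//; field.
rewrite !gt_eqF ?ltr0n ?fact_gt0 ?exprn_gt0 ?powR_gt0 ?Gamma_gt0 ?lerDr//.
Qed.

(** A geometric bound uniform in [n], for exchanging the limit in [n] with the sum
    over [j]. With [x = alpha j] and [a = n + 1], [GammaD_le_powR] and [Gamma_ge] bound
    the term by [e y^j (e (1 / x + 1 / a))^x], and the base is small once both [x]
    and [a] are large. *)
Lemma mittag_leffler_term_le {R : realType} (alpha y : R) : 0 < alpha -> 0 < y ->
  exists N : nat, forall n j, (N <= n)%N -> (N <= j)%N ->
  y ^+ j * (Gamma (n.+1%:R + alpha * j%:R) /
     (Gamma n.+1%:R * n.+1%:R `^ (alpha * j%:R))) / Gamma (alpha * j%:R + 1)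
  <= expR 1 * 2^-1 ^+ j.
Proof.
move=> a0 y0.
(* Threshold at which [y k^alpha = 1 / 2]. *)
pose k : R := (2 * y) `^ (- alpha^-1).
have y20 : 0 < 2 * y by rewrite mulr_gt0.
have k0 : 0 < k by rewrite powR_gt0.
have kE : k `^ alpha = (2 * y)^-1.
  by rewrite -powRrM mulNr mulVf ?gt_eqF// powRN powRr1// ltW.
(* If [x] and [a] are both at least [B], then [e (1 / x + 1 / a) <= k]. *)
pose B := 2 * expR 1 / k.
have B0 : 0 < B by rewrite divr_gt0// mulr_gt0// expR_gt0.
pose N := (Num.truncn (B + B / alpha)).+1.
have BN : B + B / alpha < N%:R by exact: truncnS_gt.
have Ba0 : 0 < B / alpha by rewrite divr_gt0.
exists N => n j Nn Nj.
set x := alpha * j%:R; set a := n.+1%:R.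
have a1 : 1 <= a :> R by rewrite ler1n.
have a0' : 0 < a by lra.
have Ba : B <= a.
  have : N%:R <= a :> R by rewrite ler_nat ltnW.
  lra.
have Bx : B <= x.
  have : N%:R <= j%:R :> R by rewrite ler_nat.
  rewrite /x mulrC -ler_pdivrMr//; lra.
have x0 : 0 < x by lra.
have G0 := Gamma_gt0 a a1.
have ax0 : 0 < a + x by lra.
have h1 : Gamma (a + x) / (Gamma a * a `^ x) <= ((a + x) / a) `^ x.
  rewrite ler_pdivrMr ?mulr_gt0 ?powR_gt0// mulrC -mulrA -powRM ?(ltW a0')//; last first.
    by rewrite divr_ge0 ?ltW.
  by rewrite (mulrC a) divfK ?gt_eqF// mulrC GammaD_le_powR// ltW.
have h2 : (Gamma (x + 1))^-1 <= (x `^ x)^-1 * expR (x + 1).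
  have := Gamma_ge x (ltW x0); rewrite expRN => h.
  rewrite -[_ * expR _]invrK lef_pV2 ?posrE ?Gamma_gt0 ?invr_gt0
    ?mulr_gt0 ?invr_gt0 ?expR_gt0 ?powR_gt0//; last by lra.
  by rewrite invfM invrK.
have xx : 0 < x `^ x by rewrite powR_gt0.
have aa : 0 <= (a + x) / a by rewrite divr_ge0 ?ltW.
apply: (@le_trans _ _ (y ^+ j * ((a + x) / a) `^ x * ((x `^ x)^-1 * expR (x + 1)))).
  rewrite ler_pM ?invr_ge0 ?(ltW (Gamma_gt0 _ _))//; last 2 first.
  - by lra.
  - by rewrite ler_wpM2l ?exprn_ge0 ?(ltW y0).
  - rewrite mulr_ge0 ?exprn_ge0 ?(ltW y0)// divr_ge0 ?mulr_ge0 ?powR_ge0 ?(ltW (Gamma_gt0 _ _))//.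
    by lra.
have -> : y ^+ j * ((a + x) / a) `^ x * ((x `^ x)^-1 * expR (x + 1)) =
    expR 1 * (y ^+ j * ((a + x) / a * x^-1 * expR 1) `^ x).
  have xV : 0 <= x^-1 by rewrite invr_ge0 ltW.
  rewrite (powRM _ (mulr_ge0 aa xV) (expR_ge0 _)) (powRM _ aa xV).
  rewrite -(powR_inv1 (ltW x0)) -powRrM mulN1r powRN expRD.
  have -> : expR 1 `^ x = expR x by rewrite /powR gt_eqF ?expR_gt0// expRK mulr1.
  by ring.
rewrite ler_wpM2l ?expR_ge0//.
have -> : 2^-1 ^+ j = y ^+ j * k `^ x.
  rewrite /x powRrM kE powR_mulrn; last by rewrite invr_ge0 ltW.
  by rewrite -exprMn; congr (_ ^+ _); field; rewrite gt_eqF.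
rewrite ler_wpM2l ?exprn_ge0 ?(ltW y0)//.
rewrite ge0_ler_powR ?nnegrE ?(ltW x0) ?(ltW k0)//.
  by rewrite !mulr_ge0 ?expR_ge0 ?invr_ge0 ?(ltW a0') ?(ltW x0)//; lra.
have -> : (a + x) / a * x^-1 * expR 1 = (x^-1 + a^-1) * expR 1.
  by field; rewrite !gt_eqF.
have E0 : 0 < expR 1 :> R by rewrite expR_gt0.
have V z : 0 < z -> B <= z -> z^-1 <= k / (2 * expR 1).
  move=> z0 Bz; rewrite -(invrK (k / _)) lef_pV2 ?posrE ?invr_gt0 ?divr_gt0 ?mulr_gt0//.
  by rewrite invf_div.
have Vx := V x x0 Bx; have Va := V a a0' Ba.
rewrite -ler_pdivlMr//.
have <- : k / (2 * expR 1) + k / (2 * expR 1) = k / expR 1 by field; rewrite gt_eqF.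
exact: lerD.
Qed.

(** Tannery's argument, on lower bounds only: partial sums of the approximating
    series are at least minus a geometric tail, and this passes to the limit in [n]. *)
Lemma mittag_leffler_ge0 {R : realType} (alpha y : R) :
  0 < alpha < 1 -> 0 <= y -> 0 <= mittag_leffler alpha (- y).
Proof.
move=> /[dup] a01 /andP[a0 a1]; rewrite le_eqVlt => /predU1P[<-|y0].
  rewrite /mittag_leffler oppr0 (_ : limn _ = (1 : R)) ?ler01//.
  apply: lim_near_cst => //.
  near=> n; have n0 : (0 < n)%N by near: n; exact: nbhs_infty_gt.
  rewrite /series/= -(prednK n0) big_nat_recl// big1_seq ?addr0.
    by rewrite expr0 mulr0 add0r Gamma1 divr1.
  by move=> i _; rewrite expr0n mul0r.
pose T j : R := (- y) ^+ j / Gamma (alpha * j%:R + 1).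
pose r n j : R := Gamma (n.+1%:R + alpha * j%:R) /
     (Gamma n.+1%:R * n.+1%:R `^ (alpha * j%:R)).
pose Tn n j : R := (- y) ^+ j * r n j / Gamma (alpha * j%:R + 1).
pose q n : R := y / n.+1%:R `^ alpha.
have aj j : 0 <= alpha * j%:R by rewrite mulr_ge0 ?(ltW a0).
have Gj j : 0 < Gamma (alpha * j%:R + 1) by rewrite Gamma_gt0// lerDr.
have rge0 n j : 0 <= r n j.
  have n1 : 1 <= n.+1%:R :> R by rewrite ler1n.
  by rewrite divr_ge0 ?mulr_ge0 ?powR_ge0 ?(ltW (Gamma_gt0 _ _))//; have := aj j; lra.
have TnT j : Tn n j @[n --> \oo] --> T j.
  rewrite /T -[X in X / _]mulr1; apply: cvgMl; apply: cvgMr.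
  exact: Gamma_shift_cvg.
have [N hN] := mittag_leffler_term_le alpha y a0 y0.
have Tnb n j : (N <= n)%N -> (N <= j)%N -> `|Tn n j| <= expR 1 * 2^-1 ^+ j.
  move=> Nn Nj; rewrite /Tn normrM [X in X * _]normrM normrX normrN (ger0_norm (ltW y0)).
  by rewrite (ger0_norm (rge0 _ _)) ger0_norm ?invr_ge0 ?(ltW (Gj _))// hN.
have Tb j : (N <= j)%N -> `|T j| <= expR 1 * 2^-1 ^+ j.
  move=> Nj; apply: (cvgr_to_le (cvg_norm (TnT j))).
  by exists N => // n /= Nn; exact: Tnb.
have cT : cvgn (series T).
  (* The finite sum absorbs the terms below the threshold [N]. *)
  pose C := expR 1 + \sum_(j < N) `|T j| * 2 ^+ j.
  have S0 : 0 <= \sum_(j < N) `|T j| * 2 ^+ j by apply: sumr_ge0 => i _; rewrite mulr_ge0.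
  have e0 := expR_ge0 (1 : R).
  apply: normed_cvg; apply: (series_le_cvg (v_ := geometric C 2^-1)).
  - by move=> j; exact: normr_ge0.
  - by move=> j; rewrite /= mulr_ge0 ?exprn_ge0 ?addr_ge0.
  - move=> j /=; have [Nj|jN] := leqP N j.
      by apply: (le_trans (Tb j Nj)); rewrite ler_wpM2r ?exprn_ge0// lerDl.
    rewrite exprVn ler_pdivlMr ?exprn_gt0//.
    rewrite /C (bigD1 (Ordinal jN))//= addrCA lerDl addr_ge0//.
    by apply: sumr_ge0 => i _; rewrite mulr_ge0.
  - by apply: is_cvg_geometric_series; rewrite ger0_norm//; lra.
have tail n J : (N <= n)%N -> (N <= J)%N -> q n < 1 ->
    0 <= \sum_(j < J) Tn n j + 2 * expR 1 * 2^-1 ^+ J.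
  move=> Nn NJ qn.
  have q0 : 0 < q n by rewrite divr_gt0// powR_gt0.
  have [l l0 hl] := multichoose_series_ge0 alpha (q n) n a01 (introT andP (conj q0 qn)).
  apply: (le_trans l0); apply: (cvgr_to_le hl).
  exists J => // K /= JK; rewrite -(subnKC JK).
  rewrite (eq_bigr (fun j : 'I_(J + (K - J)) => Tn n j)); last first.
    by move=> j _; rewrite /q multichoose_shift// ltW.
  suff : \sum_(j < J + (K - J)) Tn n j <= \sum_(j < J) Tn n j +
      2 * expR 1 * (2^-1 ^+ J - 2^-1 ^+ (J + (K - J))).
    move=> h; apply: (le_trans h); rewrite lerD2l ler_wpM2l ?mulr_ge0 ?expR_ge0//.
    by rewrite gerBl exprn_ge0.
  elim: (K - J)%N => [|i IH]; first by rewrite addn0 subrr mulr0 addr0.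
  rewrite addnS big_ord_recr /=.
  have := Tnb n (J + i)%N Nn (leq_trans NJ (leq_addr _ _)).
  move=> /ler_normlW h; apply: (le_trans (lerD IH h)).
  by rewrite exprS -addrA lerD2l; lra.
have tailT J : (N <= J)%N -> 0 <= series T J + geometric (2 * expR 1) 2^-1 J.
  move=> NJ; rewrite /series /= big_mkord.
  apply: (@cvgr_to_ge _ \oo _ _ (fun n => \sum_(j < J) Tn n j + 2 * expR 1 * 2^-1 ^+ J)).
    apply: cvgD; last exact: cvg_cst.
    by apply: cvg_big => [|i _]; [exact: add_continuous|exact: TnT].
  near=> n; apply: tail => //; first by near: n; exact: nbhs_infty_ge.
  rewrite /q ltr_pdivrMr ?powR_gt0// mul1r.
  have yE : y = (y `^ alpha^-1) `^ alpha.
    by rewrite -powRrM mulVf ?gt_eqF// powRr1// ltW.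
  rewrite [ltLHS]yE gt0_ltr_powR ?nnegrE ?powR_ge0//.
  near: n; exists (Num.truncn (y `^ alpha^-1)) => // n /= hn.
  by apply: (lt_le_trans (truncnS_gt _)); rewrite ler_nat.
have -> : mittag_leffler alpha (- y) = limn (series T) + 0 by rewrite addr0.
apply: (@cvgr_to_ge _ \oo _ _ (fun J => series T J + geometric (2 * expR 1) 2^-1 J)).
  apply: cvgD; first exact: cT.
  by apply: cvg_geometric; rewrite ger0_norm//; lra.
by exists N => // J /= NJ; exact: tailT.
Unshelve. all: by end_near. Qed.

(** * Functions with a non-negative Fourier transform *)

Lemma integrable_exponential_bounded {R : realType} (e : R) (g : R -> R) (M : R) :
  0 < e -> measurable_fun setT g -> (forall k, `|g k| <= M) ->
  lebesgue_measure.-integrable setT (EFin \o (fun k => exponential_pdf e k * g k)).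
Proof.
move=> e0 mg gM.
have i1 := @integrableZl _ _ R lebesgue_measure _ measurableT M _ (integrable_exponential_pdf e0).
refine (@le_integrable _ _ R lebesgue_measure _ _ _ _ _ _ i1) => //.
  apply/measurable_EFinP; apply: measurable_funM => //.
  exact: measurable_exponential_pdf.
move=> k _ /=; rewrite lee_fin normrM mulrC normrM ler_wpM2r//.
by rewrite (le_trans (gM k))// ler_norm.
Qed.

(** The integrand changes sign, so the positive function obtained from [1 + cos] is
    integrated by its primitive, and the total mass 1 of the exponential density is
    subtracted. *)
Lemma exponential_cos_transform {R : realType} (e z : R) : 0 < e ->
  \int[lebesgue_measure]_k (exponential_pdf e k * cos (k * z)) =
  e ^+ 2 / (e ^+ 2 + z ^+ 2).
Proof.
move=> e0.
have d0 : 0 < e ^+ 2 + z ^+ 2 by rewrite ltr_wpDr ?sqr_ge0// exprn_gt0.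
have mcos : measurable_fun setT (fun k : R => cos (k * z)).
  apply: measurableT_comp; first exact: continuous_measurable_fun (@continuous_cos R).
  exact: mulrr_measurable.
have ic : lebesgue_measure.-integrable setT
    (EFin \o (fun k => exponential_pdf e k * cos (k * z))).
  by apply: (integrable_exponential_bounded _ _ 1) => // k; exact: cos_max.
have ie := integrable_exponential_pdf e0.
pose f k := e * expR (- e * k) * (1 + cos (k * z)).
(* A primitive of [f] on the whole line, vanishing at infinity. *)
pose G k := - expR (- e * k) +
  e / (e ^+ 2 + z ^+ 2) * (expR (- e * k) * (z * sin (k * z) - e * cos (k * z))).
have dG (k : R) : is_derive k (1 : R) G (f k).
  apply: is_derive_eq.
  rewrite /GRing.scale /= /f; field.
  by rewrite gt_eqF.
have cG : continuous G.
  by move=> k; apply/differentiable_continuous/derivable1_diffP; have [] := dG k.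
have cf : continuous f.
  move=> k; apply: cvgM.
    apply: cvgMr; apply: continuous_comp; last exact: continuous_expR.
    by apply: cvgMr; exact: cvg_id.
  apply: cvgD; first exact: cvg_cst.
  apply: continuous_comp; last exact: continuous_cos.
  by apply: cvgMl; exact: cvg_id.
have Gy : G k @[k --> +oo] --> (0 : R).
  pose C := 1 + `|e / (e ^+ 2 + z ^+ 2)| * (`|z| + `|e|).
  apply: norm_cvg0; apply: (@squeeze_cvgr _ _ _ _ (cst 0) (fun k => C * expR (- (e * k)))).
  - near=> k; rewrite normr_ge0/=.
    have E := expR_gt0 (- e * k).
    apply: (le_trans (ler_normD _ _)); rewrite normrN normrM (normrM (expR _)) !(gtr0_norm E).
    rewrite /C mulNr mulrDl mul1r lerD2l mulrCA mulrC ler_wpM2r ?expR_ge0//.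
    rewrite ler_wpM2l//; apply: (le_trans (ler_normB _ _)); rewrite !normrM.
    by apply: lerD; rewrite ler_piMr// ?sin_max ?cos_max.
  - exact: cvg_cst.
  - rewrite -(mulr0 C); apply: cvgMr.
    apply: (@cvg_comp _ _ _ (fun k => e * k) (fun x => expR (- x))
      _ (pinfty_nbhs R)); last exact: cvgr_expR.
    exact: gt0_cvgMry.
have I1 : \int[lebesgue_measure]_(k in `[0, +oo[) f k = 0 - G 0.
  apply: Rintegral_ge0_continuous_FTC2y => //.
  - move=> k k0; rewrite /f !mulr_ge0 ?(ltW e0) ?expR_ge0//.
  - exact: continuous_subspaceT.
  - by apply/cvg_at_right_filter; exact: cG.
  - by move=> k _; rewrite derive1E; have [_ ->] := dG k.
have I2 : \int[lebesgue_measure]_(k in `[0, +oo[) f k =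
    1 + \int[lebesgue_measure]_k (exponential_pdf e k * cos (k * z)).
  have -> : (1 : R) = \int[lebesgue_measure]_k exponential_pdf e k.
    by rewrite /Rintegral integral_exponential_pdf.
  rewrite -RintegralD// Rintegral_mkcond; apply: eq_Rintegral => k _.
  rewrite patchE; case: ifPn => [|].
    rewrite inE/= in_itv/= andbT => k0; rewrite exponential_pdfE//.
    by rewrite /f mulrDr mulr1.
  rewrite notin_setE/= in_itv/= andbT => /negP; rewrite -ltNge => k0.
  by rewrite lt0_exponential_pdf// mul0r addr0.
move: I1; rewrite I2 /G mulr0 expR0 mul0r sin0 cos0 => h.
rewrite -[LHS](addKr 1) h; field.
by rewrite gt_eqF.
Unshelve. all: by end_near. Qed.

(** What matters is that the mass is the same for all centres [x], and of order [e]
    when [e <= d]. *)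
Lemma cauchy_kernel_near_mass {R : realType} (e x d : R) : 0 < e -> 0 < d ->
  \int[lebesgue_measure]_(y in `[x - d, x + d]) (e ^+ 2 / (e ^+ 2 + (x - y) ^+ 2)) =
  2 * e * atan (d / e).
Proof.
move=> e0 d0.
pose G y := e * atan ((y - x) / e).
have en0 : e != 0 by rewrite gt_eqF.
have dpos y : 0 < e ^+ 2 + (x - y) ^+ 2 by rewrite ltr_wpDr ?sqr_ge0// exprn_gt0.
have dG (y : R) : is_derive y (1 : R) G (e ^+ 2 / (e ^+ 2 + (x - y) ^+ 2)).
  apply: is_derive_eq.
  have d1 : 1 + ((y - x) / e) ^+ 2 != 0 by rewrite gt_eqF// ltr_wpDr ?sqr_ge0.
  rewrite /GRing.scale /=; field.
  by rewrite en0 gt_eqF.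
have cG : continuous G.
  by move=> k; apply/differentiable_continuous/derivable1_diffP; have [] := dG k.
have cf : continuous (fun y : R => e ^+ 2 / (e ^+ 2 + (x - y) ^+ 2)).
  move=> y; apply: cvgMr; apply: cvgV; first by rewrite gt_eqF.
  apply: cvgD; first exact: cvg_cst.
  by apply: cvgM; apply: cvgB; [exact: cvg_cst|exact: cvg_id|exact: cvg_cst|exact: cvg_id].
rewrite /Rintegral (continuous_FTC2 (F := G)).
- rewrite /G -EFinB /=.
  have -> : (x + d - x) / e = d / e by rewrite (addrC x) addrK.
  have -> : (x - d - x) / e = - (d / e) by rewrite addrAC subrr add0r mulNr.
  by rewrite atanN; ring.
- lra.
- exact: continuous_subspaceT.
- split; first by move=> y _; have [] := dG y.
  + by apply/cvg_at_right_filter; exact: cG.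
  + by apply/cvg_at_left_filter; exact: cG.
- by move=> k _; rewrite derive1E; have [_ ->] := dG k.
Qed.

Lemma integrableMbounded {R : realType} (f g : R -> R) (M : R) :
  lebesgue_measure.-integrable setT (EFin \o f) ->
  measurable_fun setT g -> (forall y, `|g y| <= M) ->
  lebesgue_measure.-integrable setT (EFin \o (fun y => g y * f y)).
Proof.
move=> fi mg gM.
have i1 := @integrableZl _ _ R lebesgue_measure _ measurableT M _ fi.
refine (@le_integrable _ _ R lebesgue_measure _ _ _ _ _ _ i1) => //.
  apply/measurable_EFinP; apply: measurable_funM => //.
  by have /integrableP[/measurable_EFinP] := fi.
move=> k _ /=; rewrite lee_fin !normrM ler_wpM2r//.
by rewrite (le_trans (gM k))// ler_norm.
Qed.

(** By [exponential_cos_transform] and Fubini, the integral equals that of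
    [exponential_pdf e k * (1 - cos (k x))] against the cosine transform of [f], all of
    whose factors are non-negative; the sine transform drops out after expanding
    [cos (k (x - y))]. *)
Lemma cauchy_kernel_positive_definite {R : realType} (f : R -> R) (e x : R) : 0 < e ->
  lebesgue_measure.-integrable setT (EFin \o f) ->
  (forall k, \int[lebesgue_measure]_y (sin (k * y) * f y) = 0) ->
  (forall k, 0 <= \int[lebesgue_measure]_y (cos (k * y) * f y)) ->
  0 <= \int[lebesgue_measure]_y
    ((e ^+ 2 / (e ^+ 2 + y ^+ 2) - e ^+ 2 / (e ^+ 2 + (x - y) ^+ 2)) * f y).
Proof.
move=> e0 fi fsin fcos.
have mf : measurable_fun setT f by have /integrableP[/measurable_EFinP] := fi.
pose w (y k : R) : R := exponential_pdf e k * (cos (k * y) - cos (k * (x - y))).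
pose h (p : R * R) : \bar R := (w p.1 p.2 * f p.1)%:E.
have wM y k : `|w y k| <= exponential_pdf e k * 2.
  rewrite normrM (ger0_norm (exponential_pdf_ge0 (ltW e0) _)).
  rewrite ler_wpM2l ?exponential_pdf_ge0 ?(ltW e0)//.
  by rewrite (le_trans (ler_normB _ _))// lerD ?cos_max.
have mcos : measurable_fun setT (@cos R).
  exact: continuous_measurable_fun (@continuous_cos R).
have mh : measurable_fun setT h.
  apply/measurable_EFinP; apply: measurable_funM; last first.
    exact: measurableT_comp.
  apply: measurable_funM.
    by apply: measurableT_comp => //; exact: measurable_exponential_pdf.
  apply: measurable_funB; apply: measurableT_comp => //; apply: measurable_funM => //.
  exact: measurable_funB.
have wi y : lebesgue_measure.-integrable setT (EFin \o w y).
  apply: (integrable_exponential_bounded _ _ 2) => //.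
    by apply: measurable_funB; apply: measurableT_comp => //; exact: mulrr_measurable.
  by move=> k; rewrite (le_trans (ler_normB _ _))// (_ : 2 = 1 + 1)// lerD ?cos_max.
have hi : (lebesgue_measure \x lebesgue_measure)%E.-integrable setT h.
  apply/integrable12ltyP => //.
  have i1 := @integrableZl _ _ R lebesgue_measure _ measurableT 2 _
    (integrable_abse fi).
  have /integrableP[mg] := i1; apply: le_lt_trans.
  apply: ge0_le_integral => //.
  - by move=> y _; apply: integral_ge0.
  - have mah : measurable_fun setT (abse \o h) by exact: measurableT_comp.
    have ah0 p : (0 <= (abse \o h) p)%E by exact: abse_ge0.
    exact: (measurable_fun_fubini_tonelli_F (m2 := lebesgue_measure) _ mah ah0).
  - exact: measurableT_comp.
  move=> y _ /=.
  have -> : (`|2 * `|f y| |%R)%:E =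
     (\int[lebesgue_measure]_k (2 * `|f y| * exponential_pdf e k)%:E)%E.
    under eq_integral do rewrite EFinM.
    rewrite integralZl//; last exact: integrable_exponential_pdf.
    by rewrite integral_exponential_pdf// mule1 ger0_norm// mulr_ge0.
  apply: ge0_le_integral => //.
  - apply/measurable_EFinP; apply: measurableT_comp => //.
    apply: measurable_funM => //.
    by have /integrableP[/measurable_EFinP] := wi y.
  - by apply/measurable_EFinP; apply: measurable_funM => //; exact: measurable_exponential_pdf.
  - move=> k _; rewrite /= lee_fin normrM (mulrC (2 * _)) mulrA.
    by rewrite ler_wpM2r// wM.
have inner1 y : (\int[lebesgue_measure]_k h (y, k) =
    ((e ^+ 2 / (e ^+ 2 + y ^+ 2) - e ^+ 2 / (e ^+ 2 + (x - y) ^+ 2)) * f y)%:E)%E.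
  rewrite /h /=; under eq_integral do rewrite mulrC EFinM.
  rewrite integralZl//; last exact: wi.
  rewrite (mulrC _ (f y)) EFinM; congr (_ * _)%E.
  rewrite -[LHS]fineK; last first.
    exact: (@integrable_fin_num _ _ R lebesgue_measure _ measurableT _ (wi y)).
  congr EFin; rewrite -[LHS]/(\int[lebesgue_measure]_k w y k).
  rewrite /w; under eq_Rintegral do rewrite mulrBr.
  have bi z : lebesgue_measure.-integrable setT
      (EFin \o (fun k => exponential_pdf e k * cos (k * z))).
    apply: (integrable_exponential_bounded _ _ 1) => // [|k]; last exact: cos_max.
    by apply: measurableT_comp => //; exact: mulrr_measurable.
  by rewrite RintegralB// !exponential_cos_transform.
have inner2 k : (0 <= \int[lebesgue_measure]_y h (y, k))%E.
  have ci : lebesgue_measure.-integrable setT (EFin \o (fun y => cos (k * y) * f y)).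
    apply: (integrableMbounded _ _ 1) => // [|y]; last exact: cos_max.
    by apply: measurableT_comp => //; exact: mulrl_measurable.
  have si : lebesgue_measure.-integrable setT (EFin \o (fun y => sin (k * y) * f y)).
    apply: (integrableMbounded _ _ 1) => // [|y]; last exact: sin_max.
    apply: measurableT_comp; first exact: continuous_measurable_fun (@continuous_sin R).
    exact: mulrl_measurable.
  have wE y : w y k * f y = exponential_pdf e k *
      ((1 - cos (k * x)) * (cos (k * y) * f y) - sin (k * x) * (sin (k * y) * f y)).
    by rewrite /w (mulrBr k) cosB; ring.
  have ci' : lebesgue_measure.-integrable setT
      (EFin \o (fun y => (1 - cos (k * x)) * (cos (k * y) * f y))).
    exact: (@integrableZl _ _ R lebesgue_measure _ measurableT _ _ ci).
  have si' : lebesgue_measure.-integrable setT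
      (EFin \o (fun y => sin (k * x) * (sin (k * y) * f y))).
    exact: (@integrableZl _ _ R lebesgue_measure _ measurableT _ _ si).
  have csi : lebesgue_measure.-integrable setT
      (EFin \o (fun y => (1 - cos (k * x)) * (cos (k * y) * f y) -
         sin (k * x) * (sin (k * y) * f y))).
    exact: (@integrableB _ _ R lebesgue_measure _ measurableT _ _ ci' si').
  rewrite /h /=; under eq_integral do rewrite wE EFinM.
  rewrite (@integralZl _ _ R lebesgue_measure _ measurableT _ csi).
  apply: mule_ge0.
    by rewrite lee_fin exponential_pdf_ge0// ltW.
  rewrite -[leRHS]fineK ?lee_fin; last first.
    exact: (@integrable_fin_num _ _ R lebesgue_measure _ measurableT _ csi).
  rewrite -[leRHS]/(\int[lebesgue_measure]_y ((1 - cos (k * x)) * (cos (k * y) * f y) -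
         sin (k * x) * (sin (k * y) * f y))).
  rewrite RintegralB// !RintegralZl// fsin mulr0 subr0 mulr_ge0//.
rewrite /Rintegral fine_ge0//; under eq_integral do rewrite -inner1.
by rewrite (Fubini hi); apply: integral_ge0.
Qed.

(** Suppose [f 0 < f x]. The kernel centred at 0 then averages smaller values than
    the one centred at [x], by at least [eta] times the mass [kappa] of the kernel
    within distance [d] of its centre, up to tails of size [e^2 / d^2] times the L^1
    norm of [f]. As [kappa] is of order [e], small [e] contradicts
    [cauchy_kernel_positive_definite]. *)
Lemma le_at_origin_of_fourier_ge0 {R : realType} (f : R -> R) :
  lebesgue_measure.-integrable setT (EFin \o f) -> continuous f ->
  (forall k, \int[lebesgue_measure]_y (sin (k * y) * f y) = 0) ->
  (forall k, 0 <= \int[lebesgue_measure]_y (cos (k * y) * f y)) ->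
  forall x, f x <= f 0.
Proof.
move=> fi cf fsin fcos x; rewrite leNgt; apply/negP => fx.
(* One third, so that a gap [eta] is left between [f 0 + eta] and [f x - eta]. *)
pose eta := (f x - f 0) / 3.
have eta0 : 0 < eta by rewrite divr_gt0// subr_gt0.
have contf (a : R) : exists2 d : R, 0 < d & forall y, `|a - y| <= d -> `|f a - f y| < eta.
  have /cvgrPdist_lt/(_ _ eta0) := cf a.
  move=> /nbhs_ballP[r /= r0 hr]; exists (r / 2); first by rewrite divr_gt0.
  by move=> y hy; apply: hr; rewrite /ball /=; apply: (le_lt_trans hy); lra.
have [d0 d00 hd0] := contf 0; have [dx dx0 hdx] := contf x.
pose d := Num.min d0 dx.
have dpos : 0 < d by rewrite lt_min d00.
have hA (y : R) : `|0 - y| <= d -> f y <= f 0 + eta.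
  move=> hy; have /hd0 : `|0 - y| <= d0 by rewrite (le_trans hy)// ge_min lexx.
  by rewrite distrC => /ltr_normlW; lra.
have hB (y : R) : `|x - y| <= d -> f x - eta <= f y.
  move=> hy; have /hdx : `|x - y| <= dx by rewrite (le_trans hy)// ge_min lexx orbT.
  by move=> /ltr_normlW; lra.
pose nf := \int[lebesgue_measure]_y `|f y|.
have nf0 : 0 <= nf by apply: Rintegral_ge0.
have a10 : 0 < atan (1 : R) by rewrite atan1 divr_gt0// pi_gt0.
(* The second bound makes the tail [2 c nf] smaller than [eta * kappa]; the first
   one ensures [atan (d / e) >= atan 1]. *)
pose e := Num.min d (eta * atan 1 * d ^+ 2 / (2 * (nf + 1))).
have nf1 : 0 < 2 * (nf + 1) by lra.
have e0 : 0 < e.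
  rewrite lt_min dpos; apply: divr_gt0 => //.
  by apply: mulr_gt0; [exact: mulr_gt0|exact: exprn_gt0].
have ed : e <= d by rewrite ge_min lexx.
have he : e * (2 * (nf + 1)) <= eta * atan 1 * d ^+ 2.
  by rewrite -ler_pdivlMr// ge_min lexx orbT.
pose P (a y : R) : R := e ^+ 2 / (e ^+ 2 + (a - y) ^+ 2).
pose c : R := e ^+ 2 / d ^+ 2.
have c0 : 0 <= c by apply: divr_ge0; exact: sqr_ge0.
have den (a y : R) : 0 < e ^+ 2 + (a - y) ^+ 2 by rewrite ltr_wpDr ?sqr_ge0// exprn_gt0.
have P0 (a y : R) : 0 <= P a y by apply: divr_ge0; [exact: sqr_ge0|exact: ltW].
have Pc (a y : R) : d < `|a - y| -> P a y <= c.
  move=> day; rewrite ler_wpM2l ?sqr_ge0// lef_pV2 ?posrE ?exprn_gt0//.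
  rewrite -[(a - y) ^+ 2]real_normK ?num_real// -[leLHS]add0r lerD ?sqr_ge0//.
  by rewrite lerXn2r ?nnegrE ?(ltW dpos) ?(ltW day).
pose B (a : R) : set R := `[a - d, a + d]%classic.
have inB (a y : R) : (y \in B a) = (`|a - y| <= d).
  by rewrite distrC ler_distl /B mem_setE in_itv /= .
pose g (y : R) : R := (f 0 + eta) * (P 0 \_ (B 0)) y - (f x - eta) * (P x \_ (B x)) y
   + 2 * c * `|f y|.
have cP a : continuous (P a).
  move=> y; apply: cvgMr; apply: cvgV; first by rewrite gt_eqF.
  apply: cvgD; first exact: cvg_cst.
  by apply: cvgM; apply: cvgB; [exact: cvg_cst|exact: cvg_id|exact: cvg_cst|exact: cvg_id].
have PiB a : lebesgue_measure.-integrable setT (EFin \o (P a \_ (B a))).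
  have iB : lebesgue_measure.-integrable (B a) (EFin \o P a).
    apply: continuous_compact_integrable; first exact: segment_compact.
    exact: continuous_subspaceT.
  rewrite -restrict_EFin.
  by have /(@integrable_mkcond _ _ R lebesgue_measure _ (EFin \o P a) (measurable_itv _)) := iB.
have fi' : lebesgue_measure.-integrable setT (EFin \o (fun y => `|f y|)).
  exact: (integrable_norm fi).
have le1 (y : R) : (P 0 y - P x y) * f y <= g y.
  have h1 : P 0 y * f y <= (f 0 + eta) * (P 0 \_ (B 0)) y + c * `|f y|.
    rewrite patchE inB; have [hy|hy] := leP `|0 - y| d.
      rewrite mulrC; apply: ler_wpDr; first by rewrite mulr_ge0.
      by rewrite ler_wpM2r// hA.
    rewrite mulr0 add0r (le_trans (ler_norm _))// normrM (ger0_norm (P0 _ _)).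
    by rewrite ler_wpM2r// Pc.
  have h2 : (f x - eta) * (P x \_ (B x)) y - c * `|f y| <= P x y * f y.
    rewrite patchE inB; have [hy|hy] := leP `|x - y| d.
      rewrite (mulrC (P x y)) lerBlDr; apply: ler_wpDr; first by rewrite mulr_ge0.
      by rewrite ler_wpM2r// hB.
    rewrite mulr0 sub0r lerNl (le_trans (ler_norm _))// normrN normrM (ger0_norm (P0 _ _)).
    by rewrite ler_wpM2r// Pc.
  rewrite /g mulrBl; lra.
have j1 := @integrableZl _ _ R lebesgue_measure _ measurableT (f 0 + eta) _ (PiB 0).
have j2 := @integrableZl _ _ R lebesgue_measure _ measurableT (f x - eta) _ (PiB x).
have j3 := @integrableZl _ _ R lebesgue_measure _ measurableT (2 * c) _ fi'.
have j12 := @integrableB _ _ R lebesgue_measure _ measurableT _ _ j1 j2.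
have j := @integrableD _ _ R lebesgue_measure _ measurableT _ _ j12 j3.
pose kappa := 2 * e * atan (d / e).
have Ig : \int[lebesgue_measure]_y g y = - eta * kappa + 2 * c * nf.
  rewrite /g RintegralD// RintegralB// !RintegralZl// -!Rintegral_mkcond.
  by rewrite !cauchy_kernel_near_mass// /eta -/nf /kappa; field.
have D0 : 0 <= \int[lebesgue_measure]_y ((P 0 y - P x y) * f y).
  rewrite (le_trans (cauchy_kernel_positive_definite f e x e0 fi fsin fcos))//.
  rewrite le_eqVlt; apply/orP; left; apply/eqP; apply: eq_Rintegral => y _.
  by rewrite /P sub0r sqrrN.
have Dg : \int[lebesgue_measure]_y ((P 0 y - P x y) * f y) <= \int[lebesgue_measure]_y g y.
  apply: le_Rintegral => //.
  have mP a : measurable_fun setT (P a) by exact: continuous_measurable_fun.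
  have Pb a : forall y, `|P a y| <= 1.
    move=> y; rewrite ger0_norm// ler_pdivrMr// mul1r lerDl sqr_ge0//.
  apply: (integrableMbounded _ _ 2) => //; first exact: measurable_funB.
  by move=> y; rewrite (le_trans (ler_normB _ _))// (_ : 2 = 1 + 1)// lerD.
have ka : 2 * e * atan 1 <= kappa.
  rewrite ler_wpM2l ?mulr_ge0 ?(ltW e0)// ?le_atan//.
  by rewrite ler_pdivlMr// mul1r.
have : eta * kappa <= 2 * c * nf by move: (le_trans D0 Dg); rewrite Ig; lra.
apply/negP; rewrite -ltNge.
apply: (@lt_le_trans _ _ (eta * (2 * e * atan 1))); last by rewrite ler_wpM2l ?(ltW eta0).
rewrite /c mulrA mulrAC ltr_pdivrMr ?exprn_gt0//.
have : e * (e * (2 * (nf + 1))) <= e * (eta * atan 1 * d ^+ 2) by rewrite ler_wpM2l ?(ltW e0).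
have : 0 < e * e by rewrite mulr_gt0.
rewrite expr2; set A := eta * _; nra.
Qed.

(** * Uniform smallness of the deviation *)

Lemma profile_continuous {R : realType} (alpha s : R) (Z : R -> R -> R) (F : R -> R) :
  profile alpha s Z F -> continuous F.
Proof.
move=> pF x; have [->|x0] := eqVneq x 0; first exact: (profile_continuous0 pF).
apply/differentiable_continuous/derivable1_diffP.
by have := profile_smooth pF (n := 0) x0; rewrite derive1n0.
Qed.

Lemma profile_le_origin {R : realType} (alpha s : R) (Z : R -> R -> R) (F : R -> R) :
  0 < alpha < 1 -> fundamental_solution alpha s Z -> profile alpha s Z F ->
  forall x, F x <= F 0.
Proof.
move=> a01 fZ pF.
have Z1 : Z ^~ 1 = F.
  by apply/funext => x; rewrite (profile_self_similar pF)// powR1 mul1r mulr1.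
have := fZ 1 ltr01; rewrite Z1 => -[Fi Ffourier].
apply: le_at_origin_of_fourier_ge0 => //; first exact: profile_continuous pF.
  by move=> k; case: (Ffourier k) => _ /eqP; rewrite oppr_eq0 => /eqP.
move=> k; case: (Ffourier k) => -> _; apply: mittag_leffler_ge0 => //.
Qed.

Lemma integral_tail {R : realType} (u : R -> R) (eps : R) :
  lebesgue_measure.-integrable setT (EFin \o u) -> 0 < eps ->
  exists2 A : R, 0 < A & \int[lebesgue_measure]_y `|u y| -
    \int[lebesgue_measure]_(y in `[- A, A]) `|u y| < eps.
Proof.
move=> ui eps0.
have ui' : lebesgue_measure.-integrable setT (EFin \o (fun y => `|u y|)).
  exact: (integrable_norm ui).
have uiA (A : R) : lebesgue_measure.-integrable `[- A, A] (EFin \o (fun y => `|u y|)).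
  exact: (@integrableS _ _ R lebesgue_measure _ _ _ _ (measurable_itv _) _ ui').
pose B (n : nat) : set R := `[- n%:R, n%:R]%classic.
have UB : \bigcup_n B n = setT.
  apply/seteqP; split => // y _; exists (Num.truncn `|y|).+1 => //.
  by rewrite /B /= in_itv /= -ler_norml ltW// truncnS_gt.
have cv : (\int[lebesgue_measure]_(y in B n) `|u y|%:E)%E @[n --> \oo] -->
    (\int[lebesgue_measure]_y `|u y|%:E)%E.
  rewrite -UB; apply: ge0_nondecreasing_set_cvg_integral => //.
  - move=> n m nm; rewrite subsetEset; apply: subset_itv; rewrite bnd_simp.
      by rewrite lerN2 ler_nat.
    by rewrite ler_nat.
  - by move=> n; exact: measurable_itv.
  - by move=> n; have /integrableP[] := uiA n%:R.
have cv' : \int[lebesgue_measure]_(y in B n) `|u y| @[n --> \oo] -->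
    \int[lebesgue_measure]_y `|u y|.
  apply: fine_cvg; rewrite fineK//.
  exact: (@integrable_fin_num _ _ R lebesgue_measure _ measurableT _ ui').
have [N _ hN] : \forall n \near \oo,
   `|\int[lebesgue_measure]_y `|u y| - \int[lebesgue_measure]_(y in B n) `|u y| | < eps.
  by have /cvgrPdist_lt/(_ _ eps0) := cv'.
exists N.+1%:R => //.
by have := hN N.+1 (leqnSn N); rewrite /= => /ltr_normlW.
Qed.

(** The integrand is at most [e1 |u0 y|] for [|y| <= A], as [(x - y) t^(-b)] is then
    close to 0, and at most [F 0 |u0 y|] elsewhere, as [F] has values between 0 and
    [F 0]. *)
Lemma deviation_uniform_small {R : realType} (alpha s : R) (Z : R -> R -> R)
    (F u0 : R -> R) (eps : R) :
  0 < alpha < 1 -> fundamental_solution alpha s Z -> profile alpha s Z F ->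
  lebesgue_measure.-integrable setT (EFin \o u0) -> 0 < eps ->
  exists2 d : R, 0 < d & exists A : R, forall t x : R, 0 < t ->
    A <= t `^ (alpha / (2 * s)) -> `|x| <= d * t `^ (alpha / (2 * s)) ->
    `| t `^ (alpha / (2 * s)) * mild_solution Z u0 x t -
       \int[lebesgue_measure]_y u0 y * F 0| <= eps.
Proof.
move=> a01 fZ pF ui eps0.
have Fle := profile_le_origin _ _ _ _ a01 fZ pF.
have Fgt0 := profile_gt0 pF.
have cF := profile_continuous _ _ _ _ pF.
set b := alpha / (2 * s).
pose M := \int[lebesgue_measure]_y `|u0 y|.
have M0 : 0 <= M by apply: Rintegral_ge0.
have ui' : lebesgue_measure.-integrable setT (EFin \o (fun y => `|u0 y|)).
  exact: (integrable_norm ui).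
pose e1 := eps / (2 * (M + 1)).
have e10 : 0 < e1 by rewrite divr_gt0//; lra.
pose e2 := eps / (2 * F 0).
have e20 : 0 < e2 by rewrite divr_gt0// mulr_gt0.
have [d d0 hd] : exists2 d : R, 0 < d & forall z : R, `|z| < d -> `|F 0 - F z| < e1.
  have /cvgrPdist_lt/(_ _ e10)/nbhs_ballP[r /= r0 hr] := cF 0.
  by exists r => // z zr; apply: hr; rewrite /ball /= sub0r normrN.
have [A A0 hA] := integral_tail u0 e2 ui e20.
(* With [L = t^b], the bounds [|x| <= d L / 3] and [A <= d L / 3] keep
   [|x - y| / L] strictly below [d] for [|y| <= A]. *)
exists (d / 3); first by rewrite divr_gt0.
exists (A * 3 / d) => t x t0 At xt.
set L := t `^ b in At xt *.
have L0 : 0 < L by rewrite powR_gt0.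
have Ad : A <= d / 3 * L.
  by move: At; rewrite ler_pdivrMr//; lra.
pose G y := F ((x - y) / L).
have mG : measurable_fun setT G.
  apply: continuous_measurable_fun => y; apply: continuous_comp; last exact: cF.
  by apply: cvgMl; apply: cvgB; [exact: cvg_cst|exact: cvg_id].
have Gb y : `|G y| <= F 0 by rewrite ger0_norm; [exact: Fle|exact/ltW/Fgt0].
have Gi := integrableMbounded _ _ _ ui mG Gb.
have -> : L * mild_solution Z u0 x t = \int[lebesgue_measure]_y (G y * u0 y).
  rewrite /mild_solution -RintegralZl//; last first.
    have := @integrableZl _ _ R lebesgue_measure _ measurableT L^-1 _ Gi.
    apply: eq_integrable => // y _ /=.
    by rewrite (profile_self_similar pF)// -/b powRN -/L EFinM muleA.
  apply: eq_Rintegral => y _.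
  by rewrite (profile_self_similar pF)// -/b powRN -/L /G !mulrA divff ?mul1r ?gt_eqF.
rewrite mulrC -RintegralZl// -RintegralB//; last first.
  exact: (@integrableZl _ _ R lebesgue_measure _ measurableT _ _ ui).
have GFi : lebesgue_measure.-integrable setT (EFin \o (fun y => (G y - F 0) * u0 y)).
  apply: (integrableMbounded _ _ (F 0 + F 0)) => //; first exact: measurable_funB.
  by move=> y; rewrite (le_trans (ler_normB _ _))// lerD// ger0_norm// ltW.
under eq_Rintegral do rewrite -mulrBl.
apply: (le_trans (le_normr_Rintegral measurableT GFi)).
pose h y := e1 * `|u0 y| + F 0 * (`|u0 y| - ((fun y => `|u0 y|) \_ `[- A, A]) y).
have iA : lebesgue_measure.-integrable setT (EFin \o ((fun y => `|u0 y|) \_ `[- A, A])).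
  rewrite -restrict_EFin.
  have iB : lebesgue_measure.-integrable `[- A, A] (EFin \o (fun y => `|u0 y|)).
    exact: (@integrableS _ _ R lebesgue_measure _ _ _ _ (measurable_itv _) _ ui').
  by have /(@integrable_mkcond _ _ R lebesgue_measure _ _ (measurable_itv _)) := iB.
have j1 := @integrableZl _ _ R lebesgue_measure _ measurableT e1 _ ui'.
have j2 := @integrableB _ _ R lebesgue_measure _ measurableT _ _ ui' iA.
have j3 := @integrableZl _ _ R lebesgue_measure _ measurableT (F 0) _ j2.
have j := @integrableD _ _ R lebesgue_measure _ measurableT _ _ j1 j3.
apply: (@le_trans _ _ (\int[lebesgue_measure]_y h y)).
  apply: le_Rintegral => //; first exact: (integrable_norm GFi).
  move=> y _; rewrite normrM /h patchE; case: ifPn.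
    rewrite mem_setE/= in_itv/= -ler_norml => yA.
    rewrite subrr mulr0 addr0 ler_wpM2r// distrC ltW//; apply: hd.
    rewrite normrM normfV (gtr0_norm L0) ltr_pdivrMr//.
    rewrite (le_lt_trans (ler_normB _ _))//.
    have : 0 < d * L by rewrite mulr_gt0.
    by lra.
  move=> _; rewrite subr0 [leRHS]addrC; apply: ler_wpDr.
    by rewrite mulr_ge0 ?(ltW e10)//.
  rewrite ler_wpM2r// ler_norml; have := Fle ((x - y) / L); have := Fgt0 ((x - y) / L).
  by rewrite -/(G y); lra.
rewrite /h RintegralD// !RintegralZl// RintegralB// -Rintegral_mkcond -/M.
have : F 0 * (M - \int[lebesgue_measure]_(y in `[- A, A]) `|u0 y|) <= F 0 * e2.
  by rewrite ler_wpM2l ?(ltW (Fgt0 0)) ?(ltW hA).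
have -> : F 0 * e2 = eps / 2 by rewrite /e2; field; rewrite gt_eqF.
have : e1 * M <= eps / 2.
  rewrite /e1 mulrAC ler_pdivrMr; last lra.
  by have := mulr_ge0 (ltW eps0) M0; nra.
by lra.
Qed.

(** * Norms over balls *)

(** Monotonicity without measurability, directly from the definition of the
    integral as a supremum over simple functions below the integrand; it spares
    proving that the deviation is measurable in [x]. *)
Lemma ge0_le_integralT {d} {T : measurableType d} {R : realType}
    (mu : {measure set T -> \bar R}) (f g : T -> \bar R) :
  (forall x, 0 <= f x)%E -> (forall x, f x <= g x)%E ->
  (\int[mu]_x f x <= \int[mu]_x g x)%E.
Proof.
move=> f0 fg; have g0 x : (0 <= g x)%E := le_trans (f0 x) (fg x).
rewrite !ge0_integralTE//; apply: ereal_sup_le => _ [h hf <-].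
by exists h => // x; exact: le_trans (hf x) (fg x).
Qed.

Lemma Lnorm_on_ball_le {R : realType} (p : \bar R) (f : R -> R) (r eps : R) :
  (1 <= p)%E -> 0 < r -> 0 <= eps ->
  (forall x, ball 0 r x -> `|f x| <= eps) ->
  (Lnorm_on p (ball 0%R r) f <= (eps * (2 * r) `^ fine (p^-1)%E)%:E)%E.
Proof.
move=> p1 r0 eps0 hf; rewrite /Lnorm_on unlock.
have r20 : 0 <= 2 * r by rewrite mulr_ge0// ltW.
case: p p1 => [p||//]; last first.
  move=> _; rewrite invey/= powRr0 mulr1; case: ifPn => // _.
  apply/ess_supP/nearW => x; rewrite /= lee_fin patchE.
  by case: ifPn => [/set_mem/hf//|_]; rewrite normr0.
rewrite lee_fin => p1; have p0 : 0 < p by lra.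
have pn0 : p != 0 by rewrite gt_eqF.
rewrite inver (negbTE pn0) /=.
have -> : (eps * (2 * r) `^ p^-1)%:E = poweR (eps `^ p * (2 * r))%:E p^-1.
  by rewrite poweR_EFin [in RHS]powRM ?powR_ge0// -powRrM mulfV// powRr1.
apply: gt0_ler_poweR.
- by rewrite invr_ge0 ltW.
- by rewrite in_itv/= integral_ge0 ?leey// => x _; exact: poweR_ge0.
- by rewrite in_itv/= leey lee_fin mulr_ge0 ?powR_ge0.
have -> : (eps `^ p * (2 * r))%:E = (\int[lebesgue_measure]_x
    ((cst (eps `^ p)%:E \_ (ball 0%R r)) x))%E.
  rewrite -integral_mkcond integral_cst//; last exact: measurable_ball.
  have := @lebesgue_measure_ball R 0 _ (ltW r0) => /= ->.
  by rewrite -EFinM mulr_natl.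
apply: ge0_le_integralT => x; first by rewrite lee_fin powR_ge0.
rewrite /= !patchE; case: ifPn => [/set_mem xB|_].
  by rewrite lee_fin ge0_ler_powR ?nnegrE ?(ltW p0)// hf.
by rewrite normr0 powR0.
Qed.

Lemma ge0_cvge0 {T : Type} {R : realType} (G : set_system T) (h : T -> \bar R) :
  Filter G -> (forall t, 0 <= h t)%E ->
  (forall eps : R, 0 < eps -> \forall t \near G, (h t <= eps%:E)%E) ->
  h t @[t --> G] --> 0%E.
Proof.
move=> FG h0 hle; apply/fine_cvgP; split.
  apply: filterS (hle 1 ltr01) => t ht.
  by rewrite ge0_fin_numE// (le_lt_trans ht)// ltry.
apply/cvgr0Pnorm_le => eps eps0; apply: filterS (hle _ eps0) => t ht.
rewrite ger0_norm ?fine_ge0// -lee_fin fineK// ge0_fin_numE// (le_lt_trans ht)//.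
exact: ltry.
Qed.

Lemma near_powR_ge {R : realType} (b X : R) : 0 < b ->
  \forall t \near +oo, X <= t `^ b.
Proof.
move=> b0; near=> t.
apply: (@le_trans _ _ (`|X|)); first exact: ler_norm.
have -> : `|X| = (`|X| `^ b^-1) `^ b by rewrite -powRrM mulVf ?gt_eqF// powRr1.
have hX : `|X| `^ b^-1 <= t by near: t; apply: nbhs_pinfty_ge; exact: num_real.
by rewrite ge0_ler_powR ?nnegrE ?powR_ge0 ?(ltW b0)// (le_trans (powR_ge0 _ _) hX).
Unshelve. all: by end_near. Qed.

Theorem theorem2p6 (R : realType) (alpha s : R) (p : \bar R)
    (Z : R -> R -> R) (F u0 : R -> R) :
  0 < alpha < 1 -> 0 < s < 1 -> 1 < 2 * s -> (1 <= p)%E ->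
  fundamental_solution alpha s Z ->
  profile alpha s Z F ->
  lebesgue_measure.-integrable setT (EFin \o u0) ->
  {ae lebesgue_measure, forall x, 0 <= u0 x} ->
  ~ {ae lebesgue_measure, forall x, u0 x = 0} ->
  let M := \int[lebesgue_measure]_y u0 y in
  let deviation (t x : R) :=
    t `^ (alpha / (2 * s)) * mild_solution Z u0 x t - M * F 0 in
  (forall mu : R, 0 < mu ->
     Lnorm_on p (ball 0 mu) (deviation t) @[t --> +oo] --> 0%E) /\
  (forall g : R -> R,
     (forall t, 0 < t -> 0 < g t) ->
     g t @[t --> +oo] --> +oo ->
     g =o_ (pinfty_nbhs R) (fun t : R => t `^ (alpha / (2 * s))) ->
     ((g t `^ (- fine (p^-1)%E))%R%:E * Lnorm_on p (ball 0%R (g t)) (deviation t))%E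
       @[t --> +oo] --> 0%E).
Proof.
move=> a01 s01 s2 p1 fZ pF ui _ _ M deviation.
set b := alpha / (2 * s) in deviation *.
have b0 : 0 < b by rewrite divr_gt0//; [case/andP: a01|lra].
pose q := fine (p^-1)%E.
have small (r : R -> R) (eps : R) : 0 < eps ->
    (forall d, 0 < d -> \forall t \near +oo, 0 < r t <= d * t `^ b) ->
    \forall t \near +oo,
      (Lnorm_on p (ball 0%R (r t)) (deviation t) <= (eps * (2 * r t) `^ q)%:E)%E.
  move=> eps0 hr.
  have [d d0 [A hA]] := deviation_uniform_small _ s _ _ u0 eps a01 fZ pF ui eps0.
  near=> t.
  have /andP[rt0 rtd] : 0 < r t <= d * t `^ b by near: t; exact: hr.
  apply: Lnorm_on_ball_le => //; first exact: ltW.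
  move=> x; rewrite /ball /= sub0r normrN => xr; apply: hA.
  - by near: t; exact: nbhs_pinfty_gt.
  - by near: t; exact: near_powR_ge.
  - by rewrite -/b (le_trans (ltW xr)).
split.
  move=> mu mu0; apply: ge0_cvge0 => [t|eps eps0]; first exact: Lnorm_ge0.
  have c0 : 0 < (2 * mu) `^ q by rewrite powR_gt0// mulr_gt0.
  have := small (cst mu) (eps / (2 * mu) `^ q) (divr_gt0 eps0 c0).
  rewrite /= divfK ?gt_eqF//; apply => d d0.
  near=> t; rewrite mu0/= -ler_pdivrMl//.
  by near: t; exact: near_powR_ge.
move=> g g0 gy go; apply: ge0_cvge0 => [t|eps eps0].
  by rewrite mule_ge0 ?lee_fin ?powR_ge0// Lnorm_ge0.
have c0 : 0 < (2 : R) `^ q by rewrite powR_gt0.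
have hs : \forall t \near +oo, (Lnorm_on p (ball 0%R (g t)) (deviation t) <=
    (eps / 2 `^ q * (2 * g t) `^ q)%:E)%E.
  apply: small; first exact: divr_gt0.
  move=> d d0; near=> t.
  have t0 : 0 < t by near: t; exact: nbhs_pinfty_gt.
  rewrite g0//= -[leLHS]ger0_norm ?(ltW (g0 _ t0))//.
  rewrite -[X in d * X]ger0_norm ?powR_ge0//.
  by near: t; move/eqoP: go => /(_ d d0).
near=> t.
have t0 : 0 < t by near: t; exact: nbhs_pinfty_gt.
have gt0 := g0 t t0.
apply: (@le_trans _ _ ((g t `^ (- q))%:E * (eps / 2 `^ q * (2 * g t) `^ q)%:E)%E).
  rewrite lee_wpmul2l ?lee_fin ?powR_ge0//.
  by near: t; exact: hs.
rewrite -EFinM lee_fin powRM ?(ltW gt0)// powRN le_eqVlt; apply/orP; left; apply/eqP.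
by field; rewrite !gt_eqF ?powR_gt0.
Unshelve. all: by end_near. Qed.
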